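(* Let $L$ be a bounded subset of a real Banach space $(X,\|\cdot\|)$, and let $K=\overline{\mathrm{aco}}(L)$ be the closed absolutely convex hull of $L$. Let $(M_N,d_N)_{N\in\mathbb N}$ be any one of the following families: the binary trees, the diamond graphs, the Laakso graphs. Then $L$ is not relatively super weakly compact if and only if there exist $\theta>0$ and maps $f_N:(M_N,d_N)\to X$, $N\in\mathbb N$, such that for every $N$ the map $f_N$ is $\theta$-separated and $\mathrm{ave}(f_N)\subset K$.
   Context: For a Banach space $X$, an infinite set $I$ and a free ultrafilter $\mathcal U$ on $I$, the ultrapower $X^{\mathcal U}$ is the quotient of the space $\ell_\infty(X)$ of bounded families $(x_i)_{i\in I}$ in $X$ (sup norm) by the subspace of families with $\lim_{i,\mathcal U}\|x_i\|=0$. For $A\subset X$, $A^{\mathcal U}$ is the set of classes of bounded families with all entries in $A$. A set $A\subset X$ is relatively super weakly compact if $A^{\mathcal U}$ is relatively weakly compact in $X^{\mathcal U}$ for every free ultrafilter $\mathcal U$. For a map $f:(M,d)\to(X,\|\cdot\|)$ from a metric space to a Banach space, $\mathrm{ave}(f)=\left\{\frac{f(s)-f(t)}{d(s,t)}: s,t\in M,\ s\ne t\right\}$, and $f$ is $\theta$-separated if $\|f(s)-f(t)\|\ge\theta\, d(s,t)$ for all $s,t\in M$. All graphs carry the shortest path metric. Binary trees: $T_N=\{\emptyset\}\cup\bigcup_{n=1}^N\{0,1\}^n$, two sequences being adjacent if one is obtained from the other by appending one term; thus $d(s,t)=|s|+|t|-2|a_{s,t}|$, where $|s|$ is the length of $s$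 and $a_{s,t}$ is the greatest common ancestor (longest common initial segment) of $s,t$. Diamond graphs: $D_0$ is a single edge and $D_{N}$ is obtained from $D_{N-1}$ by replacing every edge $uv$ by a 4-cycle $u,a,v,b$ (edges $ua,av,vb,bu$) with two new vertices $a,b$. Laakso graphs: $L_0$ is a single edge and $L_N$ is obtained from $L_{N-1}$ by replacing every edge $uv$ by the graph with vertices $u,a,b,c,d,v$ (with $a,b,c,d$ new) and edges $ua,ab,ac,bd,cd,dv$. *)

(* Defs.v *)
From HB Require Import structures.
From mathcomp Require Import all_boot all_order all_algebra.
From mathcomp Require Import generic_quotient ring_quotient.
From mathcomp Require Import all_classical all_reals all_analysis.

Set Implicit Arguments.
Unset Strict Implicit.
Unset Printing Implicit Defensive.

Import Order.TTheory GRing.Theory Num.Theory.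
Import numFieldNormedType.Exports.

Local Open Scope classical_set_scope.
Local Open Scope ring_scope.
Local Open Scope quotient_scope.

Structure free_ultrafilter (I : Type) := FreeUltrafilter {
  free_ultrafilter_sets :> set_system I;
  free_ultrafilter_ultra : UltraFilter free_ultrafilter_sets;
  free_ultrafilter_free : \bigcap_(A in free_ultrafilter_sets) A = set0 }.

Global Instance free_ultrafilter_proper (I : Type) (U : free_ultrafilter I) :
  ProperFilter U.
Proof. by case: (free_ultrafilter_ultra U). Qed.

Section EllInfty.
Variables (R : realType) (X : normedModType R) (I : Type).

Definition bounded_families : {pred I -> X} :=
  fun x => `[< bounded_fun x >].

Lemma bounded_familiesP (x : I -> X) :
  reflect (exists M, forall i, `|x i| <= M) (x \in bounded_families).
Proof.
apply: (iffP (asboolP _)).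
  case=> M [_ hM]; exists (M + 1) => i.
  by apply: (hM (M + 1)); rewrite ?ltrDl.
case=> M hM; exists M; split; first exact: num_real.
by move=> N MN i _; exact: le_trans (hM i) (ltW MN).
Qed.

Let bounded_families_closed : submod_closed bounded_families.
Proof.
split; first by apply/bounded_familiesP; exists 0 => i; rewrite normr0.
move=> a x y /bounded_familiesP[M hM] /bounded_familiesP[N hN].
apply/bounded_familiesP; exists (`|a| * M + N) => i.
rewrite (le_trans (ler_normD _ _))// normrZ lerD//.
by rewrite ler_wpM2l.
Qed.

HB.instance Definition _ := GRing.isSubmodClosed.Build R (I -> X)
  bounded_families bounded_families_closed.

Record ell_infty := EllInfty {
  family_of :> I -> X;
  _ : family_of \in bounded_families }.

HB.instance Definition _ := [isSub of ell_infty for family_of].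
HB.instance Definition _ := [Choice of ell_infty by <:].
HB.instance Definition _ := [SubChoice_isSubLmodule of ell_infty by <:].

Definition sup_norm (x : ell_infty) : R := sup [set `|x i| | i in [set: I]].

Let normsP (x : ell_infty) : exists M, forall i, `|x i| <= M.
Proof. by case: x => x /= /bounded_familiesP. Qed.

Lemma sup_norm_ub (x : ell_infty) i : `|x i| <= sup_norm x.
Proof.
apply: ub_le_sup; last by exists i.
by have [M hM] := normsP x; exists M => _ [j _ <-].
Qed.

Lemma sup_norm_ge0 (x : ell_infty) : 0 <= sup_norm x.
Proof.
have [[i _]|/forallNP I0] := pselect (exists _ : I, True).
  exact: le_trans (normr_ge0 _) (sup_norm_ub x i).
rewrite /sup_norm (_ : [set _ | _ in _] = set0) ?sup0//.
by rewrite -subset0 => r [j _ _]; exact: (I0 j).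
Qed.

Lemma sup_norm_le (x : ell_infty) (M : R) :
  0 <= M -> (forall i, `|x i| <= M) -> sup_norm x <= M.
Proof.
move=> M0 hM; have [[i _]|/forallNP I0] := pselect (exists _ : I, True).
  apply: ge_sup; first by exists `|x i|; exists i.
  by move=> _ [j _ <-].
rewrite /sup_norm (_ : [set _ | _ in _] = set0) ?sup0//.
by rewrite -subset0 => r [j _ _]; exact: (I0 j).
Qed.

Let sup_normD (x y : ell_infty) : sup_norm (x + y) <= sup_norm x + sup_norm y.
Proof.
apply: sup_norm_le => [|i]; first by rewrite addr_ge0 ?sup_norm_ge0.
by rewrite (le_trans (ler_normD _ _))// lerD ?sup_norm_ub.
Qed.

Let sup_normZ (a : R) (x : ell_infty) : sup_norm (a *: x) = `|a| * sup_norm x.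
Proof.
have le b z : sup_norm (b *: z) <= `|b| * sup_norm z.
  apply: sup_norm_le => [|i]; first by rewrite mulr_ge0 ?sup_norm_ge0.
  by rewrite normrZ ler_wpM2l ?sup_norm_ub.
apply/eqP; rewrite eq_le le/=.
have [->|a0] := eqVneq a 0; first by rewrite normr0 mul0r sup_norm_ge0.
rewrite -ler_pdivlMl ?normr_gt0// -normfV.
by rewrite -[leLHS](congr1 sup_norm (scalerK a0 x)) le.
Qed.

Let sup_norm0_eq0 (x : ell_infty) : sup_norm x = 0 -> x = 0.
Proof.
move=> x0; apply: val_inj; apply/funext => i.
by apply/eqP; rewrite -normr_le0 -x0 sup_norm_ub.
Qed.

HB.instance Definition _ := Lmodule_isNormed.Build R ell_infty
  sup_normD sup_normZ sup_norm0_eq0.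

Lemma ell_infty_normE (x : ell_infty) : `|x| = sup_norm x.
Proof. by []. Qed.

End EllInfty.

Section Ultrapower.
Variables (R : realType) (X : normedModType R) (I : Type).
Variable (U : free_ultrafilter I).

Definition null_families : {pred ell_infty X I} :=
  fun x => `[< `|x i| @[i --> (U : set_system I)] --> (0 : R) >].

Lemma null_familiesP (x : ell_infty X I) :
  reflect (forall e : R, 0 < e -> \forall i \near (U : set_system I), `|x i| < e)
    (x \in null_families).
Proof.
apply: (iffP (asboolP _)).
  move=> /cvgr0Pnorm_lt h e e0; move: (h _ e0).
  by apply: filterS => i /=; rewrite normr_id.
move=> h; apply/cvgr0Pnorm_lt => e e0.
by apply: filterS (h _ e0) => i; rewrite normr_id.
Qed.

Let null_families_closed : submod_closed null_families.
Proof.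
split.
  by apply/null_familiesP => e e0; apply: nearW => i; rewrite normr0.
move=> a x y /null_familiesP hx /null_familiesP hy.
apply/null_familiesP => e e0.
have a0 : 0 < `|a| + 1 by rewrite ltr_wpDl.
have e2 : 0 < e / 2 by rewrite divr_gt0.
apply: filterS2 (hx _ (divr_gt0 e2 a0)) (hy _ e2) => i xe ye.
rewrite (le_lt_trans (ler_normD _ _))// (splitr e) ler_ltD// normrZ.
rewrite (@le_trans _ _ ((`|a| + 1) * `|x i|))// ?ler_wpM2r ?lerDl//.
by rewrite -ler_pdivlMl// mulrC ltW.
Qed.

HB.instance Definition _ := GRing.isSubmodClosed.Build R (ell_infty X I)
  null_families null_families_closed.

Definition ultrapower : Type := Quotient.quot null_families.

HB.instance Definition _ := GRing.Zmodule.on ultrapower.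

Definition ultra_class (x : ell_infty X I) : ultrapower :=
  \pi_(Quotient.quot null_families) x.

Lemma ultra_classP (x y : ell_infty X I) :
  ultra_class x = ultra_class y <-> x - y \in null_families.
Proof.
by rewrite Quotient.idealrBE; split=> [/eqP|/eqP].
Qed.

Lemma ultra_class_surj (q : ultrapower) : exists x, ultra_class x = q.
Proof. by exists (repr q); exact: reprK. Qed.

Lemma ultra_classD (x y : ell_infty X I) :
  ultra_class (x + y) = ultra_class x + ultra_class y.
Proof. by rewrite /ultra_class; exact: raddfD. Qed.

Definition ultra_scale (a : R) (q : ultrapower) : ultrapower :=
  ultra_class (a *: repr q).

Let ultra_scaleE a (x : ell_infty X I) :
  ultra_scale a (ultra_class x) = ultra_class (a *: x).
Proof.
apply/ultra_classP; rewrite -scalerBr rpredZ//.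
by apply/ultra_classP; rewrite /ultra_class reprK.
Qed.

Let ultra_scaleA a b q :
  ultra_scale a (ultra_scale b q) = ultra_scale (a * b) q.
Proof.
by have [x <-] := ultra_class_surj q; rewrite !ultra_scaleE scalerA.
Qed.

Let ultra_scale1 : left_id 1 ultra_scale.
Proof.
by move=> q; have [x <-] := ultra_class_surj q; rewrite ultra_scaleE scale1r.
Qed.

Let ultra_scaleDr : right_distributive ultra_scale +%R.
Proof.
move=> a p q; have [x <-] := ultra_class_surj p.
have [y <-] := ultra_class_surj q.
by rewrite -ultra_classD !ultra_scaleE scalerDr ultra_classD.
Qed.

Let ultra_scaleDl q : {morph ultra_scale^~ q : a b / a + b}.
Proof.
move=> a b; have [x <-] := ultra_class_surj q.
by rewrite !ultra_scaleE scalerDl ultra_classD.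
Qed.

HB.instance Definition _ := GRing.Zmodule_isLmodule.Build R ultrapower
  ultra_scaleA ultra_scale1 ultra_scaleDr ultra_scaleDl.

Lemma ultra_classZ a (x : ell_infty X I) :
  ultra_class (a *: x) = a *: ultra_class x.
Proof. by rewrite -ultra_scaleE. Qed.

(* The quotient norm induced by the sup norm of ell_infty. *)
Definition ultra_norm (q : ultrapower) : R :=
  inf [set `|x| | x in [set x : ell_infty X I | ultra_class x = q]].

Let ultra_norm_le (x : ell_infty X I) : ultra_norm (ultra_class x) <= `|x|.
Proof.
by apply: ge_inf; [exists 0 => _ [y _ <-] | exists x].
Qed.

Let ultra_norm_lt q (e : R) : 0 < e ->
  exists2 x, ultra_class x = q & `|x| < ultra_norm q + e.
Proof.
move=> e0; have [|_ [x xq <-] xe] := inf_adherent e0 (E :=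
  [set `|x| | x in [set x : ell_infty X I | ultra_class x = q]]).
  split; last by exists 0 => _ [y _ <-].
  by have [x xq] := ultra_class_surj q; exists `|x|; exists x.
by exists x.
Qed.

Let ultra_norm_ge0 q : 0 <= ultra_norm q.
Proof.
apply: lb_le_inf => [|_ [y _ <-]//].
by have [x xq] := ultra_class_surj q; exists `|x|; exists x.
Qed.

Let ultra_normD p q : ultra_norm (p + q) <= ultra_norm p + ultra_norm q.
Proof.
apply/ler_addgt0Pr => e e0; have e2 : 0 < e / 2 by rewrite divr_gt0.
have [x <- xe] := ultra_norm_lt p e2.
have [y <- ye] := ultra_norm_lt q e2.
rewrite -ultra_classD (le_trans (ultra_norm_le _))//.
rewrite (le_trans (ler_normD _ _))// (splitr e) addrACA.
by rewrite lerD// ltW.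
Qed.

Let ultra_normZ a q : ultra_norm (a *: q) = `|a| * ultra_norm q.
Proof.
have le b p : ultra_norm (b *: p) <= `|b| * ultra_norm p.
  have b0 : 0 < `|b| + 1 by rewrite ltr_wpDl.
  apply/ler_addgt0Pr => e e0.
  have [x <- xe] := ultra_norm_lt p (divr_gt0 e0 b0).
  rewrite -ultra_classZ (le_trans (ultra_norm_le _))// normrZ.
  rewrite (le_trans (ler_wpM2l (normr_ge0 b) (ltW xe)))// mulrDr lerD2l//.
  by rewrite mulrCA ler_piMr ?(ltW e0)// ler_pdivrMr// mul1r lerDl.
apply/eqP; rewrite eq_le le/=.
have [->|a0] := eqVneq a 0; first by rewrite normr0 mul0r ultra_norm_ge0.
rewrite -ler_pdivlMl ?normr_gt0// -normfV.
by rewrite -[leLHS](congr1 ultra_norm (scalerK a0 q)) le.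
Qed.

Let ultra_norm0_eq0 q : ultra_norm q = 0 -> q = 0.
Proof.
have [x <-] := ultra_class_surj q => x0.
have -> : (0 : ultrapower) = ultra_class 0 by rewrite /ultra_class raddf0.
apply/ultra_classP; rewrite subr0; apply/null_familiesP => e e0.
have e2 : 0 < e / 2 by rewrite divr_gt0.
have [y /ultra_classP/null_familiesP/(_ _ e2) yx ye] :=
  ultra_norm_lt (ultra_class x) e2.
apply: filterS yx => i yxe; rewrite x0 add0r in ye.
rewrite -[x i](subKr (y i)) (le_lt_trans (ler_normB _ _))// (splitr e) ltrD//.
exact: le_lt_trans (sup_norm_ub y i) ye.
Qed.

HB.instance Definition _ := Lmodule_isNormed.Build R ultrapower
  ultra_normD ultra_normZ ultra_norm0_eq0.

Lemma ultrapower_normE (q : ultrapower) : `|q| = ultra_norm q.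
Proof. by []. Qed.

Definition ultra_set (A : set X) : set ultrapower :=
  [set ultra_class x | x in [set x : ell_infty X I | forall i, A (x i)]].

End Ultrapower.

Arguments ultrapower {R} X {I} U.
Arguments ultra_set {R X I} U A.

Section WeakTopology.
Variables (R : realType) (V : normedModType R).

Definition topological_dual : Type :=
  {phi : {linear V -> R^o} | continuous phi}.

(* V with the coarsest topology for which every continuous linear functional
   is continuous. *)
Definition weak_space : Type := sup_topology (fun phi : topological_dual =>
  Topological.class (initial_topology (sval phi : V -> R^o))).

HB.instance Definition _ := Topological.on weak_space.

Definition relatively_weakly_compact (A : set V) : Prop :=
  precompact (A : set weak_space).

End WeakTopology.

Definition relatively_super_weakly_compact (R : realType)
    (X : normedModType R) (A : set X) : Prop :=
  forall (I : Type) (U : free_ultrafilter I), infinite_set [set: I] ->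
    relatively_weakly_compact (ultra_set U A).

Definition absconvex_hull (R : realType) (X : normedModType R) (A : set X) :
    set X :=
  [set x | exists (n : nat) (a : 'I_n -> R) (y : 'I_n -> X),
    [/\ forall i, A (y i), \sum_(i < n) `|a i| <= 1
      & x = \sum_(i < n) a i *: y i]].

Definition closed_absconvex_hull (R : realType) (X : normedModType R)
  (A : set X) : set X := closure (absconvex_hull A).

Section MetricMaps.
Variables (R : realType) (M : metricType R) (X : normedModType R).
Implicit Type f : M -> X.

Definition ave f : set X :=
  [set x | exists s t, s != t /\ x = (mdist s t)^-1 *: (f s - f t)].

Definition theta_separated (theta : R) f : Prop :=
  forall s t, theta * mdist s t <= `|f s - f t|.

End MetricMaps.

Structure graph := Graph {
  vertex : finType;
  graph_adj : rel vertex;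
  graph_adj_sym : symmetric graph_adj }.

Section ShortestPath.
Variable G : graph.
Implicit Types x y z : vertex G.

Definition walk_of_length x y (n : nat) : bool :=
  [exists p : n.-tuple (vertex G),
    path (@graph_adj G) x p && (last x p == y)].

(* A shortest path has fewer than #|vertex G| edges. The value is #|vertex G|
   when no path joins x to y, which does not occur in a connected graph. *)
Definition graph_dist x y : nat :=
  find (walk_of_length x y) (iota 0 #|vertex G|).

Lemma walk_of_lengthP x y n :
  reflect (exists p, [/\ path (@graph_adj G) x p, last x p = y & size p = n])
    (walk_of_length x y n).
Proof.
apply: (iffP existsP) => [[p /andP[xp /eqP xy]]|[p [xp xy pn]]].
  by exists p; split=> //; exact: size_tuple.
have pn' : size p == n by apply/eqP.
by exists (Tuple pn'); rewrite /= xp xy eqxx.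
Qed.

Lemma graph_dist_leP x y n :
  walk_of_length x y n -> (graph_dist x y <= n)%N.
Proof.
move=> xyn; rewrite leqNgt; apply/negP => n_lt.
have nG : (n < #|vertex G|)%N.
  by rewrite (leq_trans n_lt)// -[leqRHS](size_iota 0) find_size.
by have := before_find 0 n_lt; rewrite nth_iota// add0n xyn.
Qed.

Lemma graph_distP x y : connect (@graph_adj G) x y ->
  walk_of_length x y (graph_dist x y).
Proof.
case/connectP => p xp ->; have [q xq uq _] := shortenP xp.
have qG : (size q < #|vertex G|)%N.
  by rewrite -[(size q).+1]/(size (x :: q)) -(card_uniqP uq) max_card.
have qw : walk_of_length x (last x q) (size q).
  by apply/walk_of_lengthP; exists q.
have hasw : has (walk_of_length x (last x q)) (iota 0 #|vertex G|).
  by apply/hasP; exists (size q); rewrite ?mem_iota.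
have := nth_find 0 hasw; rewrite nth_iota ?add0n//.
by rewrite -[leqRHS](size_iota 0) -has_find.
Qed.

Lemma graph_dist_le x y : (graph_dist x y <= #|vertex G|)%N.
Proof. by rewrite -[leqRHS](size_iota 0) find_size. Qed.

Lemma graph_dist_walk x y : (graph_dist x y < #|vertex G|)%N ->
  walk_of_length x y (graph_dist x y).
Proof.
move=> dG; have hasw : has (walk_of_length x y) (iota 0 #|vertex G|).
  by rewrite has_find size_iota.
by have := nth_find 0 hasw; rewrite nth_iota.
Qed.

Lemma walk_sym x y n : walk_of_length x y n -> walk_of_length y x n.
Proof.
move=> /walk_of_lengthP[p [xp <- <-]]; apply/walk_of_lengthP.
exists (rev (belast x p)); split; last by rewrite size_rev size_belast.
  by rewrite rev_path; under eq_path do rewrite graph_adj_sym.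
by case: p {xp} => //= a p; rewrite rev_cons last_rcons.
Qed.

Lemma walk_cat x y z m n : walk_of_length x y m -> walk_of_length y z n ->
  walk_of_length x z (m + n).
Proof.
move=> /walk_of_lengthP[p [xp xy <-]] /walk_of_lengthP[q [yq yz <-]].
apply/walk_of_lengthP; exists (p ++ q).
by rewrite cat_path xp xy yq last_cat xy yz size_cat.
Qed.

End ShortestPath.

Definition graph_space (R : realType) (G : graph) : Type := vertex G.

Section GraphMetric.
Variables (R : realType) (G : graph).

HB.instance Definition _ := Choice.copy (graph_space R G) (vertex G).

Let dist (x y : graph_space R G) : R := (graph_dist x y)%:R.

Let distxx x : dist x x = 0.
Proof.
rewrite /dist; have /graph_dist_leP : walk_of_length (x : vertex G) x 0.
  by apply/walk_of_lengthP; exists [::].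
by rewrite leqn0 => /eqP ->.
Qed.

Let dist_eq0 x y : dist x y = 0 -> x = y.
Proof.
move=> /eqP; rewrite pnatr_eq0 => /eqP d0.
have := @graph_dist_walk G x y; rewrite d0 => /(_ _)/walk_of_lengthP[].
  by apply/card_gt0P; exists x.
by move=> [|a p] [] // _ xy _; exact: xy.
Qed.

Let dist_sym x y : dist x y = dist y x.
Proof.
congr (_%:R); apply: eq_find => n; apply/idP/idP; exact: walk_sym.
Qed.

Let dist_triangle y x z : dist x z <= dist x y + dist y z.
Proof.
rewrite /dist -natrD ler_nat.
have [xyG|Gxy] := ltnP (graph_dist (x : vertex G) y) #|vertex G|; last first.
  exact: leq_trans (graph_dist_le _ _) (leq_trans Gxy (leq_addr _ _)).
have [yzG|Gyz] := ltnP (graph_dist (y : vertex G) z) #|vertex G|; last first.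
  exact: leq_trans (graph_dist_le _ _) (leq_trans Gyz (leq_addl _ _)).
by apply: graph_dist_leP; apply: walk_cat; exact: graph_dist_walk.
Qed.

HB.instance Definition _ := isMetric.Build R (graph_space R G)
  distxx dist_eq0 dist_sym dist_triangle.

Lemma graph_space_mdistE (x y : graph_space R G) :
  mdist x y = (graph_dist x y)%:R :> R.
Proof. by []. Qed.

End GraphMetric.

Section BinaryTree.
Variable N : nat.

(* N.-bseq bool is the type of sequences of booleans of length at most N. *)
Definition tree_adjacent : rel (N.-bseq bool) := fun s t =>
  [exists b, (t == rcons s b :> seq bool) || (s == rcons t b :> seq bool)].

Lemma tree_adjacent_sym : symmetric tree_adjacent.
Proof. by move=> s t; apply: eq_existsb => b; rewrite orbC. Qed.

Definition binary_tree : graph := Graph tree_adjacent_sym.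

End BinaryTree.

(* Graphs with an explicit type of edges, each edge being listed with an
   arbitrary orientation; the graphs replacing the edges below are symmetric
   under exchange of the two ends, so that the orientation is immaterial. *)
Structure edge_graph := EdgeGraph {
  node : finType;
  edge : finType;
  edge_ends : edge -> node * node }.

Section OfEdgeGraph.
Variable G : edge_graph.

Definition edge_adjacent : rel (node G) := fun x y =>
  [exists e : edge G, (edge_ends e == (x, y)) || (edge_ends e == (y, x))].

Lemma edge_adjacent_sym : symmetric edge_adjacent.
Proof. by move=> x y; apply: eq_existsb => e; rewrite orbC. Qed.

Definition of_edge_graph : graph := Graph edge_adjacent_sym.

End OfEdgeGraph.

(* A gadget is the graph put in place of an edge uv, given by the list of its
   edges. Its vertices are u = inl false, v = inl true and k new vertices
   inr i. *)
Definition gadget (k : nat) : Type := seq ((bool + 'I_k) * (bool + 'I_k)).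

Section ReplaceEdges.
Variables (k : nat) (H : gadget k) (G : edge_graph).

Definition gadget_node (e : edge G) (w : bool + 'I_k) :
    node G + edge G * 'I_k :=
  match w with
  | inl false => inl (edge_ends e).1
  | inl true => inl (edge_ends e).2
  | inr i => inr (e, i)
  end.

Definition replace_edges : edge_graph :=
  @EdgeGraph (node G + edge G * 'I_k)%type (edge G * 'I_(size H))%type
    (fun ej => let ab := tnth (in_tuple H) ej.2 in
       (gadget_node ej.1 ab.1, gadget_node ej.1 ab.2)).

End ReplaceEdges.

Definition single_edge : edge_graph :=
  @EdgeGraph bool unit (fun _ => (false, true)).

Definition diamond_gadget : gadget 2 :=
  let u := inl false in let v := inl true in
  let a := inr (@Ordinal 2 0 isT) in let b := inr (@Ordinal 2 1 isT) in
  [:: (u, a); (a, v); (v, b); (b, u)].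

Definition laakso_gadget : gadget 4 :=
  let u := inl false in let v := inl true in
  let a := inr (@Ordinal 4 0 isT) in let b := inr (@Ordinal 4 1 isT) in
  let c := inr (@Ordinal 4 2 isT) in let d := inr (@Ordinal 4 3 isT) in
  [:: (u, a); (a, b); (a, c); (b, d); (c, d); (d, v)].

Definition diamond_graph (N : nat) : graph :=
  of_edge_graph (iter N (replace_edges diamond_gadget) single_edge).

Definition laakso_graph (N : nat) : graph :=
  of_edge_graph (iter N (replace_edges laakso_gadget) single_edge).

Variant graph_family := BinaryTrees | DiamondGraphs | LaaksoGraphs.

Definition family_graph (F : graph_family) : nat -> graph :=
  match F with
  | BinaryTrees => binary_tree
  | DiamondGraphs => diamond_graph
  | LaaksoGraphs => laakso_graph
  end.

Lemma binary_tree_connected N (s t : vertex (binary_tree N)) :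
  connect (@graph_adj (binary_tree N)) s t.
Proof.
have root (r : N.-bseq bool) : connect (@tree_adjacent N) [bseq] r.
  case: r => r rN; elim/last_ind: r rN => [|r b ih] rN.
    by rewrite (_ : [bseq] = Bseq rN)//; exact: val_inj.
  have rN' : (size r <= N)%N by apply: leq_trans rN; rewrite size_rcons.
  apply: connect_trans (ih rN') (connect1 _).
  by apply/existsP; exists b; rewrite /= eqxx.
apply: connect_trans (root t).
by rewrite (sym_connect_sym (@tree_adjacent_sym N)).
Qed.

Definition edge_connected (G : edge_graph) : Prop :=
  forall x y : node G, connect (@edge_adjacent G) x y.

Lemma replace_edges_connected k (H : gadget k) (G : edge_graph) :
  edge_connected (@EdgeGraph (bool + 'I_k)%type 'I_(size H)
    (tnth (in_tuple H))) ->
  edge_connected G -> edge_connected (replace_edges H G).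
Proof.
move=> Hc Gc.
have inH (e : edge G) v w : connect (@edge_adjacent (replace_edges H G))
    (gadget_node e v) (gadget_node e w).
  have /connectP[p vp ->] := Hc v w; elim: p v vp => //= x p ih v.
  case/andP => vx xp; apply: connect_trans (ih _ xp); apply: connect1.
  case/existsP: vx => j vx; apply/existsP; exists (e, j) => /=.
  by case/orP: vx => /eqP /= ->; rewrite eqxx ?orbT.
have inG x y : connect (@edge_adjacent (replace_edges H G)) (inl x) (inl y).
  have /connectP[p xp ->] := Gc x y; elim: p x xp => //= z p ih x.
  case/andP => xz zp; apply: connect_trans (ih _ zp).
  case/existsP: xz => e /orP[]/eqP exz.
    by have := inH e (inl false) (inl true); rewrite /= exz.
  by have := inH e (inl true) (inl false); rewrite /= exz.
have toG x : exists y, connect (@edge_adjacent (replace_edges H G)) x (inl y).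
  case: x => [x|[e i]]; first by exists x.
  exists (edge_ends e).1; exact: (inH e (inr i) (inl false)).
move=> x y; have [x' xx'] := toG x; have [y' yy'] := toG y.
apply: connect_trans xx' (connect_trans (inG x' y') _).
by rewrite (sym_connect_sym (@edge_adjacent_sym _)).
Qed.

Lemma edge_connected_from (G : edge_graph) (x : node G) :
  (forall y, connect (@edge_adjacent G) x y) -> edge_connected G.
Proof.
move=> xG y z; apply: connect_trans (xG z).
by rewrite (sym_connect_sym (@edge_adjacent_sym _)).
Qed.

Lemma edge_connect1 (G : edge_graph) (e : edge G) (b : bool) :
  connect (@edge_adjacent G) (if b then (edge_ends e).1 else (edge_ends e).2)
    (if b then (edge_ends e).2 else (edge_ends e).1).
Proof.
apply/connect1/existsP; exists e.
by case: (edge_ends e) b => x y []; rewrite eqxx ?orbT.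
Qed.

Lemma single_edge_connected : edge_connected single_edge.
Proof.
apply: (@edge_connected_from single_edge false) => -[]; last exact: connect0.
exact: (@edge_connect1 single_edge tt true).
Qed.

Lemma diamond_graph_connected N (x y : vertex (diamond_graph N)) :
  connect (@graph_adj (diamond_graph N)) x y.
Proof.
suff : edge_connected (iter N (replace_edges diamond_gadget) single_edge).
  exact.
elim: N {x y} => [|N ih]; first exact: single_edge_connected.
apply: replace_edges_connected ih; set G := EdgeGraph _.
have e0 := @edge_connect1 G (@Ordinal 4 0 isT) true.
have e1 := @edge_connect1 G (@Ordinal 4 1 isT) true.
have e3 := @edge_connect1 G (@Ordinal 4 3 isT) false.
apply: (@edge_connected_from G (inl false)) => -[[]|[[|[|//]] i2]].
- exact: connect_trans e0 e1.
- exact: connect0.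
- by rewrite (bool_irrelevance i2 isT); exact: e0.
- by rewrite (bool_irrelevance i2 isT); exact: e3.
Qed.

Lemma laakso_graph_connected N (x y : vertex (laakso_graph N)) :
  connect (@graph_adj (laakso_graph N)) x y.
Proof.
suff : edge_connected (iter N (replace_edges laakso_gadget) single_edge).
  exact.
elim: N {x y} => [|N ih]; first exact: single_edge_connected.
apply: replace_edges_connected ih; set G := EdgeGraph _.
have e0 := @edge_connect1 G (@Ordinal 6 0 isT) true.
have e1 := @edge_connect1 G (@Ordinal 6 1 isT) true.
have e2 := @edge_connect1 G (@Ordinal 6 2 isT) true.
have e3 := @edge_connect1 G (@Ordinal 6 3 isT) true.
have e5 := @edge_connect1 G (@Ordinal 6 5 isT) true.
apply: (@edge_connected_from G (inl false)).
move=> -[[]|[[|[|[|[|//]]]] i4]]; rewrite ?(bool_irrelevance i4 isT).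
- exact: connect_trans e0 (connect_trans e1 (connect_trans e3 e5)).
- exact: connect0.
- exact: e0.
- exact: connect_trans e0 e1.
- exact: connect_trans e0 e2.
- exact: connect_trans e0 (connect_trans e1 e3).
Qed.

Lemma family_graph_connected F N (x y : vertex (family_graph F N)) :
  connect (@graph_adj (family_graph F N)) x y.
Proof.
by case: F x y; [exact: binary_tree_connected|exact: diamond_graph_connected|
  exact: laakso_graph_connected].
Qed.

(* Main.v *)
(* Both directions go through functionals rather than through convex hulls.

   If [L] is not relatively super weakly compact, some ultrapower of [L] carries
   a filter whose limit functional stays at distance [th > 0] from the
   ultrapower. Generic points x_1, ..., x_n of that filter satisfy
   |sum_j c_j x_j| >= th/2 |sum_(j >= k) c_j| for all k and all c_j in {-1,0,1},
   and this passes to points of [L] itself. So it suffices to code the vertices of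
   each graph by subsets of {1, ..., n} in such a way that adjacent vertices differ
   by one element and the graph distance is at most twice the largest difference of
   the numbers of elements in an interval.

   Conversely, separated maps give, for every N, a tree of depth N whose leaves lie
   in [K], in which every node is the average of its children and two children are
   [th]-separated. Norming functionals g_t at the nodes turn the tree into a
   martingale, and orthogonality of the increments moves all the g_t to the leaves:
   the average over the branches of sup_K (sum_t +-g_t) is at least cN. A supremum of
   a functional over [K] is one over [L], -[L] and 0, so the hull disappears, and
   this linear growth contradicts the finiteness of the rank of [L] for trees of
   half-space separations (as in the bounds of online learning by the Littlestone
   dimension). Infinite rank yields, by a Ramsey argument, ladders
   g_j(l_k) - g_j(l_i) >= al for i <= j < k, which are incompatible with weak
   compactness of the ultrapower of [L]. *)
Require Import Defs.
From HB Require Import structures.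
From mathcomp Require Import all_boot all_order all_algebra.
From mathcomp Require Import all_classical all_reals all_analysis.
From mathcomp Require Import ring lra zify.

Set Implicit Arguments.
Unset Strict Implicit.
Unset Printing Implicit Defensive.

Import Order.TTheory GRing.Theory Num.Theory.
Import numFieldNormedType.Exports.

Local Open Scope classical_set_scope.
Local Open Scope ring_scope.

(** * Norming functionals *)

Definition unit_functional (R : realType) (V : normedModType R)
  (g : {linear V -> R^o}) : Prop := forall x, `|g x| <= `|x|.

Section HahnBanach.
Variables (R : realType) (V : normedModType R).

(** A partial linear functional below the norm is encoded by its graph, a linear relation. It is
    single-valued: a pair [(0, r)] brings its multiples, so [a * r <= 0] for all [a], in particular
    for [a = r]. *)
Definition dominated_graph (Gam : set (V * R)) : Prop :=
  (forall a p q, Gam p -> Gam q -> Gam (a *: p.1 + q.1, a * p.2 + q.2)) /\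
  (forall p, Gam p -> p.2 <= `|p.1|).

(** One-dimensional step of Hahn-Banach: the triangle inequality puts every r - |x - z| below every
    |x' + z| - r', for (x, r) and (x', r') in the relation, and [c] is the supremum of the lower
    numbers. *)
Lemma dominated_graph_extend (Gam : set (V * R)) (z : V) :
  dominated_graph Gam -> Gam !=set0 ->
  exists c : R,
    dominated_graph [set q | exists p t, Gam p /\
      q = (p.1 + t *: z, p.2 + t * c)].
Proof.
move=> [lin dom] [p0 Gp0].
have comb a b p q : Gam p -> Gam q ->
    Gam (a *: p.1 + b *: q.1, a * p.2 + b * q.2).
  move=> Gp Gq.
  have Gq' : Gam (b *: q.1, b * q.2).
    have := lin (b - 1) q q Gq Gq.
    by rewrite scalerBl scale1r subrK mulrBl mul1r subrK.
  exact: (lin a p _ Gp Gq').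
have key p q : Gam p -> Gam q -> p.2 - `|p.1 - z| <= `|q.1 + z| - q.2.
  move=> Gp Gq; rewrite lerBlDr addrAC lerBrDr.
  have := dom _ (comb 1 1 p q Gp Gq); rewrite /= !scale1r !mul1r => /le_trans; apply.
  rewrite (_ : p.1 + q.1 = (q.1 + z) + (p.1 - z)) ?ler_normD//.
  by rewrite addrACA subrr addr0 addrC.
pose E := [set p.2 - `|p.1 - z| | p in Gam].
have E0 : E !=set0 by exists (p0.2 - `|p0.1 - z|); exists p0.
have Eub : has_ubound E.
  by exists (`|p0.1 + z| - p0.2) => _ [p Gp <-]; exact: key.
pose c := sup E.
have c1 p : Gam p -> p.2 - `|p.1 - z| <= c.
  by move=> Gp; apply: ub_le_sup => //; exists p.
have c2 q : Gam q -> c <= `|q.1 + z| - q.2.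
  by move=> Gq; apply: ge_sup => // _ [p Gp <-]; exact: key.
exists c; split.
  move=> a _ _ [p [t [Gp ->]]] [q [s [Gq ->]]] /=.
  exists (a *: p.1 + q.1, a * p.2 + q.2), (a * t + s); split; first exact: lin.
  congr pair => /=; last by ring.
  by rewrite scalerDr scalerA scalerDl addrACA.
move=> _ [p [t [Gp ->]]] /=.
have [t0|t0|->] := ltgtP t 0; last by rewrite scale0r mul0r !addr0; exact: dom.
  have := c1 _ (comb (- t^-1) 0 p p Gp Gp).
  rewrite /= scale0r mul0r !addr0 => h.
  have -> : p.1 + t *: z = (- t) *: ((- t^-1) *: p.1 - z).
    rewrite scalerBr scalerA mulrNN divff ?lt_eqF// scale1r.
    by rewrite scaleNr opprK.
  rewrite normrZ gtr0_norm ?oppr_gt0//.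
  rewrite -subr_ge0; have t' : 0 < - t by rewrite oppr_gt0.
  move: h; rewrite lerBlDr -(ler_pM2l t') mulrDr mulrA mulrNN divff ?lt_eqF//.
  rewrite mul1r; set w := `|_|; lra.
have := c2 _ (comb (t^-1) 0 p p Gp Gp).
rewrite /= scale0r mul0r !addr0 => h.
have -> : p.1 + t *: z = t *: (t^-1 *: p.1 + z).
  by rewrite scalerDr scalerA divff ?gt_eqF// scale1r.
rewrite normrZ gtr0_norm//.
by move: h; rewrite lerBrDr -(ler_pM2l t0) mulrDr mulrA divff ?gt_eqF// mul1r addrC.
Qed.

Lemma norming_functional (x0 : V) :
  exists2 g : {linear V -> R^o}, unit_functional g & g x0 = `|x0|.
Proof.
pose G0 : set (V * R) := [set (t *: x0, t * `|x0|) | t in setT].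
have G0dom : dominated_graph G0.
  split=> [a _ _ [t _ <-] [s _ <-]|_ [t _ <-]] /=.
    by exists (a * t + s) => //; rewrite scalerDl scalerA mulrDl mulrA.
  by rewrite normrZ ler_wpM2r// ler_norm.
(* Zorn runs over the relations whose union with [G0] is dominated, not over those containing [G0];
   this keeps the union of the empty chain admissible. *)
have [F FP Ftot|Gam [Gdom Gmax]] :=
    @Zorn_bigcup _ [set Gam | dominated_graph (Gam `|` G0)].
  split=> [a p q|p].
    move=> [[A FA Ap]|G0p] [[B FB Bq]|G0q].
    - have [AB|BA] := Ftot A B FA FB.
        have [lin _] := FP _ FB.
        by have [|h] := lin a p q (or_introl (AB _ Ap)) (or_introl Bq);
          [left; exists B|right].
      have [lin _] := FP _ FA.
      by have [|h] := lin a p q (or_introl Ap) (or_introl (BA _ Bq));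
        [left; exists A|right].
    - have [lin _] := FP _ FA.
      by have [|h] := lin a p q (or_introl Ap) (or_intror G0q);
        [left; exists A|right].
    - have [lin _] := FP _ FB.
      by have [|h] := lin a p q (or_intror G0p) (or_introl Bq);
        [left; exists B|right].
    - by right; exact: (G0dom.1).
  move=> [[A FA Ap]|G0p]; first by have [_ dom] := FP _ FA; apply: dom; left.
  exact: (G0dom.2).
have GG0 : G0 `<=` Gam.
  move=> p G0p; apply: contrapT => nGp.
  apply: (Gmax (Gam `|` G0)) => /=; last by rewrite -setUA setUid.
  split; first by left.
  by move=> /(_ p (or_intror G0p)).
have GamE : Gam `|` G0 = Gam by apply/setUidPl.
have {}Gdom : dominated_graph Gam by rewrite -GamE.
have [lin dom] := Gdom.
have G'0 : Gam (0, 0) by apply: GG0; exists 0; rewrite // scale0r mul0r.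
have Gam0 : Gam !=set0 by exists (0, 0).
have fun0 r : Gam (0, r) -> r = 0.
  move=> G0r; have h a : a * r <= 0.
    by have := dom _ (lin a _ _ G0r G'0); rewrite /= scaler0 !addr0 normr0.
  by apply/eqP; have := h r; rewrite -expr2 real_exprn_even_le0 ?num_real//=.
have tot z : exists r, Gam (z, r).
  apply: contrapT => nz; have [c cdom] := dominated_graph_extend z Gdom Gam0.
  pose B : set (V * R) := [set q | exists p t, Gam p /\
      q = (p.1 + t *: z, p.2 + t * c)].
  have GB : Gam `<=` B.
    by move=> [x r] Gxr; exists (x, r), 0; rewrite scale0r mul0r !addr0.
  apply: (Gmax B); last first.
    by rewrite /= (_ : B `|` G0 = B)//; apply/setUidPl; apply: subset_trans GB.
  split => // /(_ (z, c)); apply: contra_not nz => h; exists c; apply: h.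
  by exists (0, 0), 1; rewrite /= scale1r mul1r !add0r.
have [g gP] := choice tot.
have glin : linear (g : V -> R^o).
  move=> a x y; have := lin (-1) _ _ (lin a _ _ (gP x) (gP y)) (gP (a *: x + y)).
  rewrite /= scaleN1r addNr mulN1r => /fun0.
  by move=> /eqP; rewrite addr_eq0 eqr_opp => /eqP <-.
pose mg := GRing.isLinear.Build R V R^o _ (g : V -> R^o) glin.
pose gl : {linear V -> R^o} := HB.pack (g : V -> R^o) mg.
exists gl => [x|].
  have gx := dom _ (gP x); rewrite ler_norml gx andbT lerNl.
  have := dom _ (gP (- x)); rewrite /= normrN.
  by rewrite (_ : g (- x) = - g x)//; exact: (linearN gl).
have : Gam (x0, `|x0|) by apply: GG0; exists 1; rewrite ?scale1r ?mul1r.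
move=> /(lin (-1) _ _ (gP x0)); rewrite /= scaleN1r addNr mulN1r => /fun0.
by move=> /eqP; rewrite addr_eq0 eqr_opp => /eqP.
Qed.

End HahnBanach.

(** * Ultralimits and the weak topology *)

Section Ultralimits.
Variables (R : realType) (T : Type) (F : set_system T).
Hypothesis FU : UltraFilter F.

Lemma ultra_cvg (u : T -> R) (C : R) :
  (\forall i \near F, `|u i| <= C) -> u i @[i --> F] --> lim (u i @[i --> F]).
Proof.
move=> uC; have : (u i @[i --> F]) `[- C, C]%classic.
  by apply: filterS uC => i /=; rewrite in_itv/= ler_norml.
move=> /(segment_compact (fmap_proper_filter _ _))[l [_ lF]].
apply/cvg_ex; exists l => B lB.
have [//|FnB] := in_ultra_setVsetC (u @^-1` B) FU.
by have [z [nBz /nBz]] := lF (~` B) B FnB lB.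
Qed.

Variable V : normedModType R.
Variable h : T -> {linear V -> R^o}.
Hypothesis h1 : forall i, unit_functional (h i).

Lemma ultralimit_functional : exists2 g : {linear V -> R^o},
  unit_functional g & forall x, h i x @[i --> F] --> g x.
Proof.
pose g x : R^o := lim (h i x @[i --> F]).
have gP x : h i x @[i --> F] --> g x.
  by apply: (@ultra_cvg _ `|x|); apply: nearW => i; exact: h1.
have glin : linear g.
  move=> a x y; apply: (cvg_unique (@Rhausdorff R) (gP _)).
  rewrite (_ : (fun i => _) = (fun i => a * h i x + h i y)).
    by apply: cvgD; [apply: cvgMr|]; exact: gP.
  by apply/funext => i; rewrite linearP.
pose mg := GRing.isLinear.Build R V R^o _ g glin.
pose gl : {linear V -> R^o} := HB.pack g mg.
exists gl => //= x; apply: (cvgr_to_le (cvg_norm (gP x))).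
by apply: nearW => i; exact: h1.
Qed.

End Ultralimits.

(** * Functionals on ultrapowers *)

Section UltrapowerFunctional.
Variables (R : realType) (X : normedModType R) (I : Type).
Variable U : free_ultrafilter I.

Local Instance free_ultrafilter_ultrafilter : UltraFilter U :=
  free_ultrafilter_ultra U.

Lemma ultra_class_norm_le (x : ell_infty X I) : `|ultra_class U x| <= `|x|.
Proof.
rewrite ultrapower_normE; apply: ge_inf; last by exists x.
by exists 0 => _ [y _ <-].
Qed.

Lemma ultrapower_norm_adherent (q : ultrapower X U) (e : R) : 0 < e ->
  exists2 x, ultra_class U x = q & `|x| < `|q| + e.
Proof.
move=> e0; have [|_ [x xq <-] xe] := inf_adherent e0 (E :=
  [set `|x| | x in [set x : ell_infty X I | ultra_class U x = q]]).
  split; last by exists 0 => _ [y _ <-].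
  by have [x xq] := ultra_class_surj q; exists `|x|; exists x.
by exists x.
Qed.

(** The coordinatewise ultralimit vanishes on null families, hence descends to classes. Its norm is
    at most 1 because a class has representatives with sup norm arbitrarily close to the quotient
    norm. *)
Lemma ultrapower_functional (h : I -> {linear X -> R^o}) :
  (forall i, unit_functional (h i)) ->
  exists2 g : {linear ultrapower X U -> R^o}, unit_functional g &
    forall x : ell_infty X I, h i (x i) @[i --> (U : set_system I)] --> g (ultra_class U x).
Proof.
move=> h1.
have hb (x : ell_infty X I) i : `|h i (x i)| <= `|x|.
  by apply: le_trans (h1 _ _) _; rewrite ell_infty_normE sup_norm_ub.
pose G (x : ell_infty X I) : R^o := lim (h i (x i) @[i --> (U : set_system I)]).
have GP (x : ell_infty X I) : h i (x i) @[i --> (U : set_system I)] --> G x.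
  by apply: (@ultra_cvg _ _ _ _ _ `|x|); exact: nearW.
have Glin a x y : G (a *: x + y) = a * G x + G y.
  apply: (cvg_unique (@Rhausdorff R) (GP _)).
  rewrite (_ : (fun i => _) = (fun i => a * h i (x i) + h i (y i))).
    by apply: cvgD; [apply: cvgMr|]; exact: GP.
  by apply/funext => i; rewrite (_ : (a *: x + y) i = a *: x i + y i)// linearP.
have Gnull x : x \in null_families U -> G x = 0.
  move=> /null_familiesP x0; apply: (cvg_unique (@Rhausdorff R) (GP _)).
  apply/cvgr0Pnorm_lt => e e0; apply: filterS (x0 e e0) => i.
  exact/le_lt_trans/h1.
have Gclass x y : ultra_class U x = ultra_class U y -> G x = G y.
  move=> /ultra_classP/Gnull; rewrite (_ : x - y = (-1) *: y + x).
    by rewrite Glin mulN1r => /eqP; rewrite addrC subr_eq0 => /eqP.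
  by rewrite scaleN1r addrC.
pose g (q : ultrapower X U) : R^o := G (repr q).
have gE x : g (ultra_class U x) = G x by apply: Gclass; exact: reprK.
have glin : linear g.
  move=> a p q; have [x <-] := ultra_class_surj p.
  have [y <-] := ultra_class_surj q.
  by rewrite -ultra_classZ -ultra_classD !gE Glin.
pose mg := GRing.isLinear.Build R (ultrapower X U) R^o _ g glin.
pose gl : {linear ultrapower X U -> R^o} := HB.pack g mg.
exists gl => [q|x]; last by rewrite /= gE; exact: GP.
apply/ler_addgt0Pr => e e0; have [x <- /ltW xe] := ultrapower_norm_adherent q e0.
apply: le_trans xe; rewrite /= gE.
by apply: (cvgr_to_le (cvg_norm (GP x))); exact: nearW.
Qed.

End UltrapowerFunctional.

Lemma unit_functional_continuous (R : realType) (V : normedModType R)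
  (g : {linear V -> R^o}) : unit_functional g -> continuous g.
Proof.
move=> g1; apply: bounded_linear_continuous; apply/ex_bound; exists 1.
apply/nbhs_normP; exists 1; rewrite /mkset ?ltr01// => x /=.
by rewrite sub0r normrN => /ltW; apply: le_trans; exact: g1.
Qed.

Section WeakTopologyFacts.
Variables (R : realType) (V : normedModType R).

Lemma weak_cvgP (F : set_system V) (y : V) : Filter F ->
  F --> (y : weak_space V) <->
  forall g : {linear V -> R^o}, continuous g -> g x @[x --> F] --> g y.
Proof.
move=> FF; rewrite cvg_sup; split=> h.
  move=> g gc B gB; apply: (h (exist _ g gc)).
  exact: (@initial_continuous _ _ (g : V -> R^o)).
move=> [g gc] B /= [_ [[C oC <-] gCy CB]].
by apply: filterS CB _; apply: (h g gc); exact: open_nbhs_nbhs.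
Qed.

Lemma weak_continuous (g : {linear V -> R^o}) : continuous g ->
  continuous (g : weak_space V -> R^o).
Proof.
move=> gc x; apply: (weak_cvgP (F := nbhs (x : weak_space V)) x _).1 gc.
exact: cvg_id.
Qed.

End WeakTopologyFacts.

(** * Ladders *)

Lemma free_ultrafilter_nat : exists U : free_ultrafilter nat,
  \oo `<=` (U : set_system nat).
Proof.
have [G [GU ooG]] := ultraFilterLemma (@eventually_filter).
suff G0 : \bigcap_(A in G) A = set0 by exists (FreeUltrafilter GU G0).
rewrite -subset0 => n /(_ [set m | (n < m)%N] (ooG _ (nbhs_infty_gt n))).
by rewrite /= ltnn.
Qed.

Lemma bounded_setP (R : realType) (X : normedModType R) (L : set X) :
  bounded_set L -> exists2 M : R, 0 < M & forall x, L x -> `|x| <= M.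
Proof.
move=> [M [_ LM]]; exists (`|M| + 1); first by rewrite ltr_wpDl.
by move=> x; apply: LM; rewrite (le_lt_trans (ler_norm _))// ltrDl.
Qed.

Lemma cluster_closed (T : topologicalType) (F : set_system T) (A : set T) (p : T) :
  closed A -> F A -> cluster F p -> A p.
Proof. by move=> cA FA Fp; apply: cA => B pB; exact: Fp. Qed.

Lemma weakly_closed_halfspace (R : realType) (V : normedModType R)
    (g : {linear V -> R^o}) (a : R) : continuous g ->
  closed ([set x | a <= g x] : set (weak_space V)).
Proof.
move=> /weak_continuous gc.
exact: (closed_comp (fun x _ => gc x) (@closed_ge R a)).
Qed.

(** The pattern of James for weak noncompactness: the functional of index j separates the points up
    to j from the later ones by the gap [al]. *)
Definition ladder (R : realType) (X : normedModType R) (al : R) (n : nat)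
    (l : nat -> X) (g : nat -> {linear X -> R^o}) : Prop :=
  forall i j k, (i <= j < k)%N -> (k < n)%N -> al <= g j (l k) - g j (l i).

(** An ultrapower over [nat] glues the ladders of all lengths into an infinite one. For a weak
    cluster point [x] of its points and an ultralimit [G] of its functionals, passing to the limit
    in k, then j, then i leaves [al <= 0]. *)
Lemma ladders_not_super_weakly_compact (R : realType) (X : normedModType R)
    (L : set X) (al : R) : bounded_set L -> 0 < al ->
  (forall n, exists l g, [/\ forall i, L (l i), forall j, unit_functional (g j)
     & ladder al n l g]) ->
  ~ relatively_super_weakly_compact L.
Proof.
move=> /bounded_setP[M M0 LM] al0 /choice[l /choice[g lgP]] Lswc.
have [U ooU] := free_ultrafilter_nat.
have UF := free_ultrafilter_ultra U.
have lb i : (fun n => l n i) \in @bounded_families R X nat.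
  apply/bounded_familiesP; exists M => n; apply: LM.
  by have [+ _ _] := lgP n; exact.
pose xi i : ultrapower X U := ultra_class U (EllInfty (lb i)).
have /choice[gam gamP] j : exists G : {linear ultrapower X U -> R^o},
    unit_functional G /\
    forall x : ell_infty X nat,
      g n j (x n) @[n --> (U : set_system nat)] --> G (ultra_class U x).
  have [|G G1 GP] := @ultrapower_functional _ X _ U (fun n => g n j).
    by move=> n; have [_ + _] := lgP n; exact.
  by exists G.
have step i j k : (i <= j < k)%N -> al <= gam j (xi k) - gam j (xi i).
  move=> ijk; have [_ gj] := gamP j.
  apply: (cvgr_to_ge (cvgB (gj (EllInfty (lb k))) (gj (EllInfty (lb i))))).
  apply: (@filterS _ _ _ [set n | (k < n)%N]) => [n kn|].
    by have [_ _] := lgP n; exact.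
  by apply: ooU; exact: nbhs_infty_gt.
have [K LK [cK _]] := Lswc nat U infinite_nat.
have [x [_ xix]] : K `&` cluster (xi @ \oo : set_system (weak_space _)) !=set0.
  apply: cK; apply: (@filterE _ \oo) => i; apply: LK.
  by exists (EllInfty (lb i)) => // n /=; have [+ _ _] := lgP n; exact.
have [G G1 GP] := @ultralimit_functional _ _ _ UF _ gam (fun j => (gamP j).1).
have closedA (h : {linear ultrapower X U -> R^o}) b :
    unit_functional h -> closed ([set y | b <= h y] : set (weak_space _)).
  by move=> /unit_functional_continuous; exact: weakly_closed_halfspace.
have limk i j : (i <= j)%N -> al + gam j (xi i) <= gam j x.
  move=> ij; apply: (cluster_closed (closedA _ _ (gamP j).1) _ xix).
  apply: (filterS _ (nbhs_infty_gt j)) => k jk /=.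
  by rewrite -lerBrDr step// ij.
have limj i : al + G (xi i) <= G x.
  rewrite -lerBrDr; apply: (cvgr_to_ge (cvgB (GP x) (GP (xi i)))).
  apply: ooU; apply: (filterS _ (nbhs_infty_ge i)) => j ij.
  by rewrite lerBrDr limk.
have : al - G x <= (- G x).
  suff : al - G x <= (\- G) x by [].
  have nG1 : unit_functional (\- G) by move=> y; rewrite /= normrN.
  apply: (cluster_closed (closedA (\- G) _ nG1) _ xix); apply: (@filterE _ \oo) => i /=.
  by rewrite lerBlDr addrC lerBrDr limj.
by rewrite gerDr leNgt al0.
Qed.

(** * Shattering *)

Section Shattering.
Variables (R : realType) (X : normedModType R) (al : R).

Local Notation test := ({linear X -> R^o} * R)%type.
Implicit Types (GG : set test) (A : set X).

(** Littlestone trees with margin [al]: the test at a node may depend on the branch leading to it,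
    and every branch is followed by a point of [A]. *)
Fixpoint shattered (d : nat) GG A : Prop :=
  if d is d'.+1 then exists2 p : test, GG p &
    shattered d' GG (A `&` [set x | p.1 x <= p.2]) /\
    shattered d' GG (A `&` [set x | p.2 + al <= p.1 x])
  else A !=set0.

Lemma shattered_sub d GG GG' A A' : GG `<=` GG' -> A `<=` A' ->
  shattered d GG A -> shattered d GG' A'.
Proof.
move=> GG'S; elim: d A A' => [|d ih] A A' AA' /=; first exact: subset_nonempty.
move=> [p GGp [Al Ar]]; exists p; first exact: GG'S.
by split; [apply: ih Al|apply: ih Ar]; exact: setSI.
Qed.

Lemma shattered_nonempty d GG A : shattered d GG A -> A !=set0.
Proof.
elim: d A => //= d ih A [p _ [/ih[x [Ax _]] _]]; by exists x.
Qed.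

(** Nodes are coloured by the two classes. If the root is in [G1], either both subtrees contain a
    [G1]-tree of depth m - 1, which the root joins, or one of them already contains a [G2]-tree of
    depth n. *)
Lemma shattered_ramsey k m n G1 G2 A : (m + n <= k)%N ->
  shattered k (G1 `|` G2) A -> shattered m G1 A \/ shattered n G2 A.
Proof.
elim: k m n A => [|k ih] m n A mnk sh.
  by left; move: mnk sh; rewrite leqn0 addn_eq0 => /andP[/eqP-> _].
have A0 := shattered_nonempty sh.
have sub d G B : shattered d G (A `&` B) -> shattered d G A.
  by apply: shattered_sub => // x [].
case: sh => p [Gp|Gp] [shl shr].
  case: m mnk => [|m] mnk; first by left.
  have [hl|/sub] := ih m n _ mnk shl; last by right.
  have [hr|/sub] := ih m n _ mnk shr; last by right.
  by left; exists p.
case: n mnk => [|n] mnk; first by right.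
rewrite addnS in mnk.
have [/sub|hl] := ih m n _ mnk shl; first by left.
have [/sub|hr] := ih m n _ mnk shr; first by left.
by right; exists p.
Qed.

(** A ladder built upwards: each chosen point restricts the later tests to those keeping it below
    their middle level, each chosen test restricts the later points to its upper side. The remaining
    gap is [al / 2]. *)
Fixpoint half_ladder (n : nat) GG A : Prop :=
  if n is n'.+1 then exists (l : X) (p : test),
    [/\ A l, GG p, p.1 l <= p.2 + al / 2
      & half_ladder n' (GG `&` [set q : test | q.1 l <= q.2 + al / 2])
          (A `&` [set x | p.2 + al <= p.1 x])]
  else True.

Lemma half_ladder_sub n GG GG' A A' : GG `<=` GG' -> A `<=` A' ->
  half_ladder n GG A -> half_ladder n GG' A'.
Proof.
elim: n GG GG' A A' => // n ih GG GG' A A' GS AS [l [p [Al Gp pl h]]].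
exists l, p; split=> //; [exact: AS|exact: GS|].
by apply: ih h; exact: setSI.
Qed.

(** The lower and upper sides are exchanged: [- g <= - c - al] means [c + al <= g]. *)
Definition opposite_tests GG : set test :=
  [set q : test | exists2 p, GG p & q = (\- p.1 : {linear X -> R^o}, - p.2 - al)].

(* The value at a point [l] of [A] splits the tests in two classes; a large
   subtree uses only one of the classes, and half of it is separated from [l]
   by its own root. Reusing the points in this way costs half of the gap. *)
Lemma shattered_half_ladder m n : exists d, forall GG A, shattered d GG A ->
  half_ladder m GG A \/ half_ladder n (opposite_tests GG) A.
Proof.
elim: m n => [|m ihm] n; first by exists 0%N => *; left.
elim: n => [|n [d2 ihn]]; first by exists 0%N => *; right.
have [d1 {}ihm] := ihm n.+1.
(* The root of the monochromatic tree serves as the next test, which costs one level in each colour.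
   In [G1] its upper subtree is continued, in [G2] its lower one. *)
exists (d1.+1 + d2.+1)%N => GG A sh; have [l Al] := shattered_nonempty sh.
pose G1 := GG `&` [set q : test | q.1 l <= q.2 + al / 2].
pose G2 := GG `&` [set q : test | q.2 + al / 2 <= q.1 l].
have : shattered (d1.+1 + d2.+1) (G1 `|` G2) A.
  apply: shattered_sub sh => // q Gq; rewrite /G1 /G2 -setIUr; split=> //=.
  by apply/orP; exact: le_total.
move=> /(shattered_ramsey (leqnn _))[[p [Gp pl] [_ sh1]]|[p [Gp pl] [sh2 _]]].
  have [h|h] := ihm _ _ sh1; [left; by exists l, p|right].
  by apply: half_ladder_sub h => [_ [q [Gq _] ->]|x []//]; exists q.
have [h|h] := ihn _ _ sh2.
  by left; apply: half_ladder_sub h => [q []//|x []//].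
right; exists l, (\- p.1 : {linear X -> R^o}, - p.2 - al); split=> //=.
- by exists p.
- by move: pl => /=; rewrite lerNl; lra.
- apply: half_ladder_sub h => [_ [q [Gq ql] ->]|x [Ax px]] /=.
    split; first by exists q.
    by move: ql => /=; rewrite lerNl; lra.
  by split=> //=; move: px => /=; rewrite subrK lerN2.
Qed.

Lemma half_ladder_ladder n GG A : half_ladder n GG A ->
  exists (l : nat -> X) (p : nat -> test), forall i, (i < n)%N ->
    [/\ A (l i), GG (p i),
      forall j, (j <= i)%N -> (p i).1 (l j) <= (p i).2 + al / 2
      & forall j, (i < j < n)%N -> (p i).2 + al <= (p i).1 (l j)].
Proof.
elim: n GG A => [|n ih] GG A; first by exists (fun=> 0), (fun=> (\0 : {linear X -> R^o}, 0)).
move=> [l0 [p0 [Al Gp pl /ih[l [p lpP]]]]].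
exists (fun i => if i is i'.+1 then l i' else l0).
exists (fun i => if i is i'.+1 then p i' else p0) => -[_|i].
  split=> // -[|j]//= jn.
  by have [[]] := lpP j jn.
rewrite ltnS => iN; have [[Ali _] [Gpi pil] h1 h2] := lpP i iN.
split=> // -[|j]//=; first exact: h1.
by rewrite !ltnS; exact: h2.
Qed.

End Shattering.

Lemma not_shattered_of_super_weakly_compact (R : realType) (X : normedModType R)
    (L : set X) (al : R) : bounded_set L -> 0 < al ->
  relatively_super_weakly_compact L ->
  exists d, ~ shattered al d [set p : {linear X -> R^o} * R | unit_functional p.1] L.
Proof.
move=> Lb al0 swc; apply: contrapT => /forallNP nsh.
pose GG : set ({linear X -> R^o} * R) := [set p : {linear X -> R^o} * R | unit_functional p.1].
have oppGG : opposite_tests al GG `<=` GG.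
  by move=> _ [p Gp ->] x /=; rewrite normrN; exact: Gp.
have al2 : 0 < al / 2 by rewrite divr_gt0.
apply: (ladders_not_super_weakly_compact Lb al2 _ swc) => n.
have [d dP] := shattered_half_ladder X al n.+1 n.+1.
have /half_ladder_ladder[l [p lpP]] : half_ladder al n.+1 GG L.
  have [//|] := dP GG L (contrapT (nsh d)).
  exact: half_ladder_sub.
(* A half-ladder of length [n.+1] controls the indices up to [n]; truncation at [n] puts every point
   in [L] and makes every functional a unit one. *)
exists (fun i => l (minn i n)), (fun j => (p (minn j n)).1); split.
- by move=> i; have [] := lpP (minn i n) (geq_minr _ _).
- by move=> i; have [] := lpP (minn i n) (geq_minr _ _).
move=> i j k /andP[ij jk] kn.
rewrite !(minn_idPl _) ?(ltnW kn)//; try lia.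
have [|_ _ h1 h2] := lpP j; first by lia.
have := h1 i ij; have := h2 k; rewrite jk ltnS (ltnW kn) => /(_ isT).
by lra.
Qed.

(** * Exponential moments over test trees *)

Section ExponentialBounds.
Variables (R : realType) (X : normedModType R) (lam : R).
Hypothesis lam0 : 0 < lam.

Inductive test_tree : Type :=
| Leaf
| Node of {linear X -> R^o} & test_tree & test_tree & test_tree & test_tree.

Fixpoint unit_tree (N : nat) (T : test_tree) : Prop :=
  match N, T with
  | 0%N, Leaf => True
  | N'.+1, Node g T1 T2 T3 T4 => unit_functional g /\
      [/\ unit_tree N' T1, unit_tree N' T2, unit_tree N' T3 & unit_tree N' T4]
  | _, _ => False
  end.

(* [w] dominates the average over the branches of [T] of the supremum over [A]
   of [expR (lam * S)], where [S] is [G] plus the sum of [g], [- g], [0] or [0]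
   over the nodes met, according to the child chosen. *)
Fixpoint exp_bound (A : set X) (T : test_tree) (G : X -> R) (w : R) : Prop :=
  match T with
  | Leaf => 0 <= w /\ forall x, A x -> expR (lam * G x) <= w
  | Node g T1 T2 T3 T4 => exists w1 w2 w3 w4,
      [/\ exp_bound A T1 (fun x => G x + g x) w1,
          exp_bound A T2 (fun x => G x - g x) w2,
          exp_bound A T3 G w3, exp_bound A T4 G w4
        & (w1 + w2 + w3 + w4) / 4 <= w]
  end.

Lemma exp_bound_le A T G w w' : w <= w' -> exp_bound A T G w -> exp_bound A T G w'.
Proof.
case: T => [|g T1 T2 T3 T4] ww' /=.
  move=> [w0 h]; split=> [|x Ax]; first exact: le_trans w0 ww'.
  exact: le_trans (h x Ax) ww'.
move=> [w1 [w2 [w3 [w4 [h1 h2 h3 h4 h]]]]]; exists w1, w2, w3, w4; split=> //.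
exact: le_trans h ww'.
Qed.

Lemma exp_bound_shift A A' T G G' w (m : R) : A' `<=` A ->
  (forall x, A' x -> G' x <= G x + m) -> exp_bound A T G w ->
  exp_bound A' T G' (expR (lam * m) * w).
Proof.
move=> AA'; elim: T G G' w => [|g T1 ih1 T2 ih2 T3 ih3 T4 ih4] G G' w GG' /=.
  move=> [w0 h]; split=> [|x Ax]; first by rewrite mulr_ge0// expR_ge0.
  apply: le_trans (ler_wpM2l (expR_ge0 _) (h x (AA' _ Ax))).
  by rewrite -expRD ler_expR -mulrDr ler_pM2l// addrC GG'.
move=> [w1 [w2 [w3 [w4 [h1 h2 h3 h4 h]]]]].
exists (expR (lam * m) * w1), (expR (lam * m) * w2), (expR (lam * m) * w3),
  (expR (lam * m) * w4); split.
- by apply: ih1 h1 => x /GG'; lra.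
- by apply: ih2 h2 => x /GG'; lra.
- exact: ih3 h3.
- exact: ih4 h4.
- by rewrite -!mulrDr -mulrA ler_wpM2l// expR_ge0.
Qed.

Lemma exp_bound_sub A A' T G w : A' `<=` A -> exp_bound A T G w ->
  exp_bound A' T G w.
Proof.
move=> AA' h; rewrite -[w]mul1r -expR0 -(mulr0 lam).
by apply: exp_bound_shift h => // x _; rewrite addr0.
Qed.

Lemma exp_bound_union A B T G w w' : exp_bound A T G w -> exp_bound B T G w' ->
  exp_bound (A `|` B) T G (w + w').
Proof.
elim: T G w w' => [|g T1 ih1 T2 ih2 T3 ih3 T4 ih4] G w w' /=.
  move=> [w0 h] [w0' h']; split=> [|x []]; first by rewrite addr_ge0.
    by move=> /h hx; rewrite ler_wpDr.
  by move=> /h' hx; rewrite ler_wpDl.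
move=> [w1 [w2 [w3 [w4 [h1 h2 h3 h4 h]]]]] [v1 [v2 [v3 [v4 [k1 k2 k3 k4 k]]]]].
exists (w1 + v1), (w2 + v2), (w3 + v3), (w4 + v4); split; [exact: ih1|
  exact: ih2|exact: ih3|exact: ih4|].
by move: h k; lra.
Qed.

Lemma exp_bound_set0 T G : exp_bound set0 T G 0.
Proof.
elim: T G => [|g T1 ih1 T2 ih2 T3 ih3 T4 ih4] G /=; first by [].
by exists 0, 0, 0, 0; split => //; rewrite !addr0 mul0r.
Qed.

(** For |z| <= 1/2, (1 - z) exp z <= 1 gives exp z <= 1 + z + 2 z^2; the linear terms at y and -y
    cancel, leaving 1 + y^2. *)
Lemma exp_symmetric_le (y : R) : `|y| <= 1 / 2 ->
  (expR y + expR (- y) + 1 + 1) / 4 <= expR (y ^+ 2).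
Proof.
have key (z : R) : `|z| <= 1 / 2 -> expR z <= 1 + z + 2 * z ^+ 2.
  rewrite ler_norml => /andP[z1 z2].
  have h : (1 - z) * expR z <= 1.
    rewrite -[leRHS](expRxMexpNx_1 z) mulrC ler_wpM2l ?expR_ge0//.
    exact: expR_ge1Dx.
  have z3 : 0 < 1 - z by lra.
  rewrite -(ler_pM2l z3); apply: le_trans h _.
  rewrite -subr_ge0 (_ : _ - 1 = z ^+ 2 * (1 - 2 * z)); last by ring.
  by rewrite mulr_ge0 ?sqr_ge0//; lra.
move=> yh; have h1 := key y yh; have := key (- y); rewrite normrN sqrrN.
move=> /(_ yh) h2; apply: le_trans (expR_ge1Dx _).
by move: h1 h2; set s := y ^+ 2; lra.
Qed.

Section Upper.
Variables (al M a a' : R).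
Hypotheses (al0 : 0 < al) (M0 : 0 < M) (lamM : lam * M <= 1 / 2).
Hypothesis aE : expR (lam * (al + lam * M ^+ 2)) <= a.
Hypothesis aa' : a < a'.

(** Solves C_{d+1} (a' - a) = (a' - a) + 2 exp (lam M) C_d: the summand with C_d pays for two pieces
    of smaller rank, and C_{d+1} >= 1 covers the leaves. *)
Fixpoint exp_constant (d : nat) : R :=
  if d is d'.+1 then 1 + 2 * expR (lam * M) * exp_constant d' / (a' - a) else 0.

Lemma exp_constant_ge0 d : 0 <= exp_constant d.
Proof.
elim: d => //= d ih; rewrite addr_ge0// divr_ge0//; last by rewrite subr_ge0 ltW.
by rewrite !mulr_ge0// expR_ge0.
Qed.

Let a0 : 0 < a. Proof. exact: lt_le_trans (expR_gt0 _) aE. Qed.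
Let a'0 : 0 < a'. Proof. exact: lt_trans a0 aa'. Qed.

(** The threshold moves up from [- M] in steps of [al]. The upper part is shattered at the start and
    empty beyond [M], so some step loses the shattering. *)
Lemma threshold_exists d (g : {linear X -> R^o}) (GG : set ({linear X -> R^o} * R)) A :
  (forall x, A x -> `|g x| <= M) -> shattered al d GG A ->
  exists c, [/\ `|c| <= M, shattered al d GG (A `&` [set x | c <= g x])
    & ~ shattered al d GG (A `&` [set x | c + al <= g x])].
Proof.
move=> AM sh; pose c k : R := - M + k%:R * al.
pose P k := shattered al d GG (A `&` [set x | c k <= g x]).
have P0 : P 0%N.
  apply: shattered_sub sh => // x Ax; split=> //=; rewrite /c mul0r addr0.
  by have := AM x Ax; rewrite ler_norml => /andP[].
have Pc k : P k -> `|c k| <= M.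
  move=> /shattered_nonempty[x [Ax /= cx]]; rewrite ler_norml.
  rewrite lerDl mulr_ge0 ?(ltW al0)//=; apply: le_trans cx _.
  by have := AM x Ax; rewrite ler_norml => /andP[].
have [k nPk] : exists k, ~ P k.
  have [k kM] : exists k : nat, 2 * M / al < k%:R.
    by exists (Num.bound (2 * M / al)); rewrite archi_boundP// divr_ge0// ?mulr_ge0// ltW.
  exists k => /Pc; rewrite ler_norml => /andP[_]; rewrite /c.
  by move: kM; rewrite ltr_pdivrMr//; set u := _%:R * al; lra.
have [j [Pj nPj]] : exists j, P j /\ ~ P j.+1.
  apply: contrapT => /forallNP h; apply: nPk; elim: k => // k Pk.
  by apply: contrapT => nPk; apply: (h k).
exists (c j); split => //; first exact: Pc.
by move: nPj; rewrite /P /c -natr1 mulrDl mul1r addrA.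
Qed.

(** Induction on [N] and [d], in the manner of the optimal learner for the Littlestone dimension.
    The points where [g] is at least [al] away from a threshold [c] form two sets of smaller rank:
    they pay the crude factor exp (lam M), but with the smaller constant. On the rest [g] is within
    [al] of [c], the signs nearly cancel and the factor is at most [a]. Thus the rank affects only
    the constant, not the rate [a']. *)
Lemma exp_bound_not_shattered N T d A : unit_tree N T ->
  (forall x, A x -> `|x| <= M) ->
  ~ shattered al d [set p : {linear X -> R^o} * R | unit_functional p.1] A ->
  exp_bound A T (fun=> 0) (exp_constant d * a' ^+ N).
Proof.
set GG := [set p | _].
elim: N T d A => [|N ih] [|g T1 T2 T3 T4]//.
  move=> [|d] A _ AM /= nsh; last first.
    rewrite expr0 mulr1 mulr0 expR0; have h : 1 <= exp_constant d.+1.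
      rewrite /= lerDl divr_ge0//; last by rewrite subr_ge0 ltW.
      by rewrite !mulr_ge0// ?expR_ge0// exp_constant_ge0.
    by split=> //; exact: le_trans h.
  by split=> [|x Ax]; [rewrite mul0r|case: nsh; exists x].
elim=> [|d ihd] A gT AM nsh.
  rewrite /= mul0r (_ : A = set0); first exact: (exp_bound_set0 (Node g T1 T2 T3 T4)).
  by rewrite -subset0 => x Ax; apply: nsh; exists x.
have Cle : exp_constant d <= exp_constant d.+1.
  elim: {ihd gT AM nsh} d => [|d ihd]; first exact: exp_constant_ge0.
  rewrite /= lerD2l ler_pM2r ?invr_gt0 ?subr_gt0//.
  by rewrite ler_pM2l// mulr_gt0 ?expR_gt0.
(* If [A] is not even shattered at depth [d], the inner induction applies, since the constants
   increase with [d]. *)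
have [shd|nshd] := pselect (shattered al d GG A); last first.
  apply: exp_bound_le (ihd A gT AM nshd).
  by rewrite ler_wpM2r// exprn_ge0// ltW.
have [g1 [hT1 hT2 hT3 hT4]] := gT.
have AgM x : A x -> `|g x| <= M by move=> /AM; exact: le_trans (g1 x).
have [c [cM shc nshc]] := threshold_exists AgM shd.
(* Otherwise the test [(g, c - al)], whose upper side is shattered by [shc], would be the root of a
   tree of depth [d.+1]. *)
have nshl : ~ shattered al d GG (A `&` [set x | g x <= c - al]).
  move=> shl; apply: nsh; exists (g, c - al); rewrite /= ?subrK; first exact: g1.
  by split.
set W := exp_constant d * a' ^+ N.
have far B : B `<=` A -> ~ shattered al d GG B ->
    exp_bound B (Node g T1 T2 T3 T4) (fun=> 0) (expR (lam * M) * W).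
  move=> BA nshB; have BM x : B x -> `|x| <= M by move=> /BA; exact: AM.
  have gM x : B x -> - M <= g x <= M by move=> /BA/AgM; rewrite ler_norml.
  exists (expR (lam * M) * W), (expR (lam * M) * W), (expR (lam * M) * W),
    (expR (lam * M) * W); split; last by lra.
  - by apply: exp_bound_shift (ih T1 d B hT1 BM nshB) => // x /gM; lra.
  - by apply: exp_bound_shift (ih T2 d B hT2 BM nshB) => // x /gM; lra.
  - by apply: exp_bound_shift (ih T3 d B hT3 BM nshB) => // x /gM; lra.
  - by apply: exp_bound_shift (ih T4 d B hT4 BM nshB) => // x /gM; lra.
set V := exp_constant d.+1 * a' ^+ N.
have V0 : 0 <= V by rewrite mulr_ge0 ?exp_constant_ge0 ?exprn_ge0// ltW.
pose B := A `&` [set x | c - al <= g x <= c + al].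
have near : exp_bound B (Node g T1 T2 T3 T4) (fun=> 0) (a * V).
  have BA : B `<=` A by move=> x [].
  have BM x : B x -> `|x| <= M by move=> /BA; exact: AM.
  have nshB : ~ shattered al d.+1 GG B.
    by move=> shB; apply: nsh; apply: shattered_sub shB.
  have gc x : B x -> c - al <= g x <= c + al by case.
  (* On [B] the increments g, -g, 0, 0 are at most al + c, al - c, al, al. *)
  exists (expR (lam * (al + c)) * V), (expR (lam * (al - c)) * V),
    (expR (lam * al) * V), (expR (lam * al) * V); split.
  - by apply: exp_bound_shift (ih T1 _ B hT1 BM nshB) => // x /gc; lra.
  - by apply: exp_bound_shift (ih T2 _ B hT2 BM nshB) => // x /gc; lra.
  - by apply: exp_bound_shift (ih T3 _ B hT3 BM nshB) => // x /gc; lra.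
  - by apply: exp_bound_shift (ih T4 _ B hT4 BM nshB) => // x /gc; lra.
  rewrite -!mulrDl mulrAC ler_wpM2r//.
  apply: le_trans aE; rewrite mulrDr !mulrBr !mulrDr !expRD.
  rewrite -[X in _ + X + _]mulr1 -[X in _ + X]mulr1 -!mulrDr -mulrA.
  rewrite ler_wpM2l ?expR_ge0//.
  have lc : `|lam * c| <= lam * M by rewrite normrM (gtr0_norm lam0) ler_pM2l.
  apply: le_trans (exp_symmetric_le (le_trans lc lamM)) _.
  rewrite ler_expR mulrA -expr2 -exprMn -[leLHS]real_normK ?num_real//.
  by rewrite ler_pXn2r ?nnegrE// mulr_ge0 ?ltW.
apply: (exp_bound_le _ (exp_bound_sub _ (exp_bound_union
  (exp_bound_union (far _ _ nshc) (far _ _ nshl)) near))) => [|x Ax|x []//|x []//].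
  have CE : exp_constant d.+1 * (a' - a) =
      a' - a + 2 * expR (lam * M) * exp_constant d.
    by rewrite /= mulrDl mul1r divfK// gt_eqF// subr_gt0.
  rewrite exprS -subr_ge0.
  rewrite (_ : _ - _ = (a' - a) * a' ^+ N); last first.
    transitivity (exp_constant d.+1 * (a' - a) * a' ^+ N -
      2 * expR (lam * M) * W); last by rewrite CE /W; ring.
    by rewrite /V /W; ring.
  by rewrite mulr_ge0// ?exprn_ge0// ?subr_ge0 ltW.
have [gx|gx] := leP (c + al) (g x); first by left; left.
have [gx'|gx'] := leP (g x) (c - al); first by left; right.
by right; split=> //=; rewrite !ltW.
Qed.

End Upper.
End ExponentialBounds.

(** * Bushes *)

Section Bushes.
Variables (R : realType) (X : normedModType R).

(* Roots of quaternary trees of depth [N] with leaves in [K]: each node is the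
   average of its children, two of which are [th]-separated. *)
Fixpoint bush (K : set X) (th : R) (N : nat) (x : X) : Prop :=
  if N is N'.+1 then exists p q1 q2 r,
    [/\ [/\ bush K th N' p, bush K th N' q1, bush K th N' q2 & bush K th N' r],
      x = 4^-1 *: (p + q1 + q2 + r) & th <= `|q1 - q2|]
  else K x.

(** Carries the suprema of functionals over the closed absolutely convex hull; the point 0 makes
    them nonnegative even for empty [L]. *)
Definition symmetrized (L : set X) : set X :=
  L `|` [set - x | x in L] `|` [set 0].

(** The intersection of the closed half-spaces that contain [symmetrized L], so that a bound of a
    functional on [L], [- L] and 0 applies at once to leaves in the hull. *)
Definition bipolar (L : set X) : set X :=
  [set x | forall (G : {linear X -> R^o}) (u : R), continuous G ->
     (forall l, symmetrized L l -> G l <= u) -> G x <= u].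

Lemma bipolarN L x : bipolar L x -> bipolar L (- x).
Proof.
move=> Lx G u Gc GL; have := Lx (\- G) u; rewrite /= linearN; apply.
  by move=> y; apply: cvgN; exact: Gc.
move=> l [[Ll|[l' Ll' <-]]|->]; rewrite -linearN; apply: GL.
- by left; right; exists l.
- by left; left; rewrite opprK.
- by right; rewrite oppr0.
Qed.

Lemma closed_absconvex_hull_bipolar L : closed_absconvex_hull L `<=` bipolar L.
Proof.
move=> x Kx G u Gc GL.
have cG : closed [set y | G y <= u].
  exact: (closed_comp (fun y _ => Gc y) (@closed_le R u)).
apply: cG; apply: closureS Kx => _ [n [a [y [Ly a1 ->]]]] /=.
have u0 : 0 <= u by rewrite -(linear0 G); apply: GL; right.
rewrite linear_sum; apply: le_trans (_ : \sum_i `|a i| * u <= u); last first.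
  by rewrite -mulr_suml ler_piMl.
apply: ler_sum => i _; rewrite (_ : G (a i *: y i) = a i * G (y i)); last first.
  by rewrite linearZ.
have [ai|ai] := leP 0 (a i); first by rewrite ger0_norm// ler_wpM2l// GL//; left; left.
rewrite ltr0_norm// -mulrNN -linearN ler_wpM2l//; first by rewrite oppr_ge0 ltW.
apply: GL; left; right.
by exists (y i).
Qed.

Lemma bushN K th N x : (forall y, K y -> K (- y)) -> bush K th N x ->
  bush K th N (- x).
Proof.
move=> KN; elim: N x => [|N ih] x /=; first exact: KN.
move=> [p [q1 [q2 [r [[hp h1 h2 hr] -> d]]]]].
exists (- p), (- q1), (- q2), (- r); split; last by rewrite -opprD normrN.
  by split; exact: ih.
by rewrite -scalerN !opprD.
Qed.

(** A binary splitting is a quaternary one with both children doubled; this lets all three families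
    produce the same kind of tree. *)
Lemma bush_midpoint K th N x y : bush K th N x -> bush K th N y ->
  th <= `|x - y| -> bush K th N.+1 (2^-1 *: (x + y)).
Proof.
move=> bx by_ xy; exists x, x, y, y; split=> //.
rewrite -[x + x + y + y]addrA -!mulr2n -mulrnDl.
by rewrite -[(x + y) *+ 2]scaler_nat scalerA; congr (_ *: _); field.
Qed.

Lemma expR_mean4 (x1 x2 x3 x4 : R) :
  expR ((x1 + x2 + x3 + x4) / 4) <= (expR x1 + expR x2 + expR x3 + expR x4) / 4.
Proof.
set m := (X in expR X <= _).
have h x : expR m * (1 + (x - m)) <= expR x.
  by rewrite -[in leRHS](subrK m x) expRD [leRHS]mulrC ler_pM2l ?expR_gt0// expR_ge1Dx.
rewrite ler_pdivlMr//; move: (h x1) (h x2) (h x3) (h x4); rewrite !mulrDr !mulrN.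
have : expR m * x1 + expR m * x2 + expR m * x3 + expR m * x4 = 4 * (expR m * m).
  by rewrite /m; field.
by rewrite !mulr1; lra.
Qed.

(** Each node of [T] carries a functional norming [q1 - q2]. Adding it on the side of [q1] and
    subtracting it on the side of [q2] raises the mean by a quarter of that norm, so by at least th
    / 4 per level; Jensen transfers the gain to the exponentials. *)
Lemma bush_exp_bound L th N x : bush (bipolar L) th N x ->
  exists2 T, unit_tree N T & forall (lam : R) (G : {linear X -> R^o}) w,
    0 < lam -> continuous G -> exp_bound lam (symmetrized L) T G w ->
    expR (lam * (G x + N%:R * (th / 4))) <= w.
Proof.
elim: N x => [|N ih] x /=.
  move=> Lx; exists (Leaf X) => // lam G w lam0 Gc [_ Gw].
  (* The point 0 makes [w] positive; taking logarithms then turns the leaf bound into a bound of a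
     functional, which extends from the symmetrized set to the bipolar. *)
  have w1 : 1 <= w.
    by have := Gw 0 (or_intror erefl); rewrite linear0 mulr0 expR0.
  have w0 : 0 < w by exact: lt_le_trans w1.
  rewrite mul0r addr0 -[leRHS]lnK ?posrE// ler_expR mulrC -ler_pdivlMr//.
  apply: Lx => // l Ll; rewrite ler_pdivlMr// mulrC -ler_expR lnK ?posrE//.
  exact: Gw.
move=> [p [q1 [q2 [r [[/ih[Tp uTp hTp] /ih[T1 uT1 hT1] /ih[T2 uT2 hT2]]]]]]].
move=> /ih[Tr uTr hTr] -> d.
have [g g1 gq] := norming_functional (q1 - q2).
have gc := unit_functional_continuous g1.
exists (Node g T1 T2 Tp Tr) => //= lam G w lam0 Gc.
move=> [w1 [w2 [w3 [w4 [h1 h2 h3 h4 hw]]]]]; apply: le_trans hw.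
have cD : continuous (G \+ g) by move=> y; exact: cvgD (Gc y) (gc y).
have cB : continuous (G \- g) by move=> y; exact: cvgB (Gc y) (gc y).
have {}h1 := hT1 lam (G \+ g) w1 lam0 cD h1.
have {}h2 := hT2 lam (G \- g) w2 lam0 cB h2.
have {}h3 := hTp lam G w3 lam0 Gc h3.
have {}h4 := hTr lam G w4 lam0 Gc h4.
have i4 : (0 : R) <= 4^-1 by rewrite invr_ge0.
apply: le_trans (ler_wpM2r i4 (lerD (lerD (lerD h1 h2) h3) h4)).
apply: le_trans (expR_mean4 _ _ _ _).
rewrite ler_expR -!mulrDr -mulrA ler_pM2l//= linearZ !linearD /=.
rewrite -gq linearB /= in d.
have -> : N.+1%:R * (th / 4) = N%:R * (th / 4) + th / 4.
  by rewrite -natr1 mulrDl mul1r.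
set n := N%:R * _; rewrite /GRing.scale /=; move: d => /= d; lra.
Qed.

Lemma shattered_opp al d L :
  shattered al d [set p : {linear X -> R^o} * R | unit_functional p.1]
    [set - x | x in L] ->
  shattered al d [set p : {linear X -> R^o} * R | unit_functional p.1] L.
Proof.
elim: d L => [|d ih] L /=; first by move=> [_ [x Lx _]]; exists x.
move=> [[g a] /= g1 [hl hr]].
exists (\- g : {linear X -> R^o}, a) => /=; first by move=> x; rewrite /= normrN.
split; apply: ih.
  apply: shattered_sub hl => // _ [[x Lx <-]] /=; rewrite linearN => gx.
  by exists x.
apply: shattered_sub hr => // _ [[x Lx <-]] /=; rewrite linearN => gx.
by exists x.
Qed.

(** For the same test tree the upper bound grows like exp (lam N th / 6) and the lower one like exp
    (lam N th / 4), which is absurd for large [N]. *)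
Lemma bushes_not_super_weakly_compact (L : set X) (th : R) :
  bounded_set L -> 0 < th -> (forall N, exists x, bush (bipolar L) th N x) ->
  ~ relatively_super_weakly_compact L.
Proof.
move=> Lb th0 bushL swc; have [M M0 LM] := bounded_setP Lb.
pose al := th / 16; have al0 : 0 < al by rewrite divr_gt0.
have [d nshL] := not_shattered_of_super_weakly_compact Lb al0 swc.
(* Small enough for lam M <= 1/2 and lam M^2 <= al, so that al + lam M^2 <= th / 8. *)
pose lam := Num.min ((2 * M)^-1) (al / M ^+ 2).
have lam0 : 0 < lam.
  by rewrite lt_min invr_gt0 mulr_gt0//= divr_gt0// exprn_gt0.
have lamM : lam * M <= 1 / 2.
  rewrite -ler_pdivlMr//; apply: (@le_trans _ _ (2 * M)^-1).
    by rewrite ge_min lexx.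
  by rewrite invfM mul1r.
have lamal : lam * M ^+ 2 <= al.
  by rewrite -ler_pdivlMr ?exprn_gt0// ge_min lexx orbT.
pose a := expR (lam * (th / 8)); pose a' := expR (lam * (th / 6)).
have aE : expR (lam * (al + lam * M ^+ 2)) <= a.
  by rewrite ler_expR ler_pM2l//; move: lamal; rewrite /al; lra.
have aa' : a < a' by rewrite ltr_expR ltr_pM2l//; lra.
pose C := exp_constant lam M a a'.
have up N T : unit_tree N T ->
    exp_bound lam (symmetrized L) T (fun=> 0) ((C d + C d + C 1%N) * a' ^+ N).
  move=> uT; have ub := exp_bound_not_shattered lam0 al0 M0 lamM aE aa' uT.
  (* The three pieces of the symmetrized set: a tree shattered by [- L] gives one for [L] by
     changing signs, and {0} is not shattered at depth 1 because of the gap. *)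
  rewrite mulrDl [(C d + C d) * _]mulrDl; apply: exp_bound_union; first apply: exp_bound_union.
  - exact: ub.
  - by refine (ub d _ _ _) => [_ [x Lx <-]|/shattered_opp//]; rewrite normrN LM.
  - refine (ub 1%N _ _ _) => [_ ->|[p _ [[x [-> h1]] [y [-> h2]]]]]; first by rewrite normr0 ltW.
    by move: h1 h2 => /=; rewrite linear0; lra.
have C0 k : 0 <= C k by exact: (exp_constant_ge0).
set D := C d + C d + C 1%N in up.
have D0 : 0 <= D by apply: addr_ge0; [apply: addr_ge0|]; exact: C0.
have grow N : expR (lam * (th / 12) * N%:R) <= D.
  have [x /bush_exp_bound[T uT low]] := bushL N.
  have := low lam (\0 : {linear X -> R^o}) _ lam0 (@cst_continuous _ _ 0) (up N T uT).
  rewrite /= add0r /a' -expRM_natl -ler_pdivrMr ?expR_gt0// -expRN -expRD.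
  apply: le_trans; rewrite ler_expR.
  by rewrite le_eqVlt; apply/orP; left; apply/eqP; field.
pose t := lam * (th / 12).
have t0 : 0 < t by rewrite mulr_gt0// divr_gt0.
have := le_trans (expR_ge1Dx _) (grow (Num.bound (D / t))).
have := archi_boundP (divr_ge0 D0 (ltW t0)); rewrite ltr_pdivrMr// -/t mulrC.
by set s := t * _; lra.
Qed.

End Bushes.

(** * Filters without weak limit *)

Section WeakNoncompactness.
Variables (R : realType) (V : normedModType R).

Lemma weak_cvg_unit (F : set_system V) (y : V) : Filter F ->
  (forall g : {linear V -> R^o}, unit_functional g -> g x @[x --> F] --> g y) ->
  F --> (y : weak_space V).
Proof.
move=> FF h; apply/weak_cvgP => g /linear_bounded_continuous/linear_boundedP gb.
have [C [C0 gC]] : exists C : R, 0 < C /\ forall x, `|g x| <= C * `|x|.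
  have [C [CR gC]] := gb; exists (`|C| + 1); split; first by rewrite ltr_wpDl.
  by apply: gC; rewrite (le_lt_trans (ler_norm _))// ltrDl.
pose g' : {linear V -> R^o} := C^-1 \*: g.
have g'1 : unit_functional g'.
  move=> x; rewrite /g' /= normrZ gtr0_norm ?invr_gt0//.
  by rewrite mulrC ler_pdivrMr// mulrC.
have gE x : g x = C * g' x by rewrite /g' /= /GRing.scale/= mulrA divff ?gt_eqF ?mul1r.
rewrite (_ : (fun x => g x) = (fun x => C * g' x)); last exact/funext.
by rewrite gE; apply: cvgMr; exact: h.
Qed.

(** Noncompactness gives an ultrafilter [G] on the weak closure of [A] without weak limit. The
    traces on [A] of its weakly open members generate a filter [H] that lives on [A] itself and
    gives functionals the same limits. *)
Lemma not_weakly_compact_filter (A : set V) :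
  bounded_set A -> ~ relatively_weakly_compact A ->
  exists H : set_system V, [/\ ProperFilter H, H A,
    forall g : {linear V -> R^o}, unit_functional g -> cvg (g x @[x --> H])
    & forall y, exists2 g : {linear V -> R^o}, unit_functional g &
        ~ g x @[x --> H] --> g y].
Proof.
move=> /bounded_setP[M M0 AM]; rewrite /relatively_weakly_compact precompactE.
rewrite compact_ultra => /existsNP[G] /not_implyP[GU] /not_implyP[GA nG].
pose cA := closure (A : set (weak_space V)).
have {}nG (y : weak_space V) : ~ G --> y.
  move=> Gy; apply: nG; exists y; split=> //.
  by apply: (closed_cvg cA _ GA) => //; exact: closed_closure.
have cAM (g : {linear V -> R^o}) x : unit_functional g -> cA x -> `|g x| <= M.
  move=> g1; have gc := weak_continuous (unit_functional_continuous g1).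
  have cl : closed ([set x | `|g x| <= M] : set (weak_space V)).
    have nc : continuous (fun x : weak_space V => `|g x|).
      by move=> z; exact: (cvg_norm (gc z)).
    exact: (closed_comp (fun x _ => nc x) (@closed_le R M)).
  move=> cAx; apply: cl; apply: closureS cAx => z Az /=.
  exact: le_trans (g1 z) (AM z Az).
have Gcvg (g : {linear V -> R^o}) : unit_functional g ->
    g x @[x --> G] --> lim (g x @[x --> G]).
  by move=> g1; apply: (@ultra_cvg _ _ _ _ _ M); apply: filterS GA => x; exact: cAM.
pose H : set_system V := [set S | exists2 W : set (weak_space V),
  open W /\ G W & A `&` W `<=` S].
have HF : ProperFilter H.
  apply: Build_ProperFilter_ex => [S [W [oW GW] WS]|].
    have [z [cAz Wz]] := filter_ex (filterI GA GW).
    have [x [Ax Wx]] := cAz W (open_nbhs_nbhs (conj oW Wz)).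
    by exists x; exact: WS.
  split.
  - by exists setT => //; split; [exact: openT|exact: filterT].
  - move=> P Q [W [oW GW] WP] [Z [oZ GZ] ZQ]; exists (W `&` Z).
      by split; [exact: openI|exact: filterI].
    by move=> x [Ax [Wx Zx]]; split; [exact: WP|exact: ZQ].
  - by move=> P Q PQ [W GW WP]; exists W => //; exact: subset_trans PQ.
have Hcvg (g : {linear V -> R^o}) : unit_functional g ->
    g x @[x --> H] --> lim (g x @[x --> G]).
  move=> g1 B; rewrite nbhsE => -[C [oC Cl] CB].
  exists (g @^-1` C); last by move=> x [_ /CB].
  split; last by apply: Gcvg g1 _ _; exact: open_nbhs_nbhs.
  by have /weak_continuous/continuousP := unit_functional_continuous g1; exact.
exists H; split=> //.
- by exists setT => [|x []//]; split; [exact: openT|exact: filterT].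
- by move=> g g1; apply/cvg_ex; eexists; exact: Hcvg.
move=> y; apply: contrapT => /forall2NP hy; apply: (nG y).
apply: weak_cvg_unit => g g1.
have [//|/contrapT gy] := hy g.
by rewrite -(cvg_unique (@Rhausdorff R) (Hcvg g g1) gy); exact: Gcvg.
Qed.

End WeakNoncompactness.

(** * Completeness of ultrapowers and distance to the limit functional *)

Section UltrapowerComplete.
Variables (R : realType) (X : completeNormedModType R) (I : Type).
Variable U : free_ultrafilter I.

Lemma ultra_class_norm_near (x : ell_infty X I) (r : R) : 0 <= r ->
  (\forall i \near (U : set_system I), `|x i| <= r) -> `|ultra_class U x| <= r.
Proof.
move=> r0 xr; pose z i := if `|x i| <= r then x i else 0.
have zb : z \in @bounded_families R X I.
  by apply/bounded_familiesP; exists r => i; rewrite /z; case: ifP => //; rewrite normr0.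
have <- : ultra_class U (EllInfty zb) = ultra_class U x.
  apply/ultra_classP/null_familiesP => e e0; apply: filterS xr => i xi.
  rewrite (_ : (EllInfty zb - x) i = z i - x i)//.
  by rewrite /z xi subrr normr0.
apply: le_trans (ultra_class_norm_le _ _) _; rewrite ell_infty_normE.
by apply: sup_norm_le => // i; rewrite /= /z; case: ifP => //; rewrite normr0.
Qed.

Lemma half_expn_lt (e : R) : 0 < e -> exists m, 2 * 2^-1 ^+ m < e.
Proof.
move=> e0; have e2 : 0 < 2 / e by rewrite divr_gt0.
exists (Num.bound (2 / e)); set m := Num.bound _.
rewrite exprVn ltr_pdivrMr ?exprn_gt0// -ltr_pdivrMl// mulrC.
apply: lt_trans (archi_boundP (ltW e2)) _.
by rewrite -natrX ltr_nat ltn_expl.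
Qed.

Lemma geometric_steps (Y : normedModType R) (u : nat -> Y) :
  (forall m, `|u m.+1 - u m| <= 2^-1 ^+ m) ->
  forall m p, `|u (m + p)%N - u m| <= 2 * 2^-1 ^+ m.
Proof.
move=> um m p.
(* The subtracted term makes the induction on [p] close exactly. *)
suff : `|u (m + p)%N - u m| <= 2 * 2^-1 ^+ m - 2 * 2^-1 ^+ (m + p).
  move/le_trans; apply; rewrite gerBl mulr_ge0// exprn_ge0// invr_ge0//.
elim: p => [|p ih]; first by rewrite addn0 !subrr normr0.
rewrite addnS -(subrK (u (m + p)%N) (u (m + p).+1)) -addrA.
apply: le_trans (ler_normD _ _) _; apply: le_trans (lerD (um _) ih) _.
by rewrite (exprS _ (m + p)); set h := _ ^+ (m + p); lra.
Qed.

Lemma geometric_cvg (u : nat -> X) :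
  (forall m, `|u m.+1 - u m| <= 2^-1 ^+ m) ->
  exists l, forall m, `|l - u m| <= 2 * 2^-1 ^+ m.
Proof.
move=> /geometric_steps um; have : cvgn u.
  apply: cauchy_cvg; apply: cauchy_exP => e e0; have [m me] := half_expn_lt e0.
  exists (u m); apply: (filterS _ (nbhs_infty_ge m)) => n /= mn.
  rewrite -ball_normE /= distrC; apply: le_lt_trans me.
  by rewrite -(subnKC mn); exact: um.
move=> /cvg_ex[l ul]; exists l => m.
apply: (cvgr_to_le (cvg_norm (cvgB ul (cvg_cst (u m))))).
by apply: (filterS _ (nbhs_infty_ge m)) => n /= mn; rewrite -(subnKC mn); exact: um.
Qed.

(** The strict bound leaves room to lift each difference to a family with sup norm at most 2^-m; the
    lifts are then summed coordinate by coordinate in [X]. *)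
Lemma ultrapower_geometric_cvg (q : nat -> ultrapower X U) :
  (forall m, `|q m.+1 - q m| < 2^-1 ^+ m) ->
  exists l, forall m, `|l - q m| <= 2 * 2^-1 ^+ m.
Proof.
move=> qm.
have /choice[d dP] m : exists d : ell_infty X I,
    ultra_class U d = q m.+1 - q m /\ `|d| <= 2^-1 ^+ m.
  have := qm m; rewrite -subr_gt0 => /(ultrapower_norm_adherent (q m.+1 - q m)).
  by move=> [d dq]; rewrite addrC subrK => /ltW dm; exists d.
have [x0 x0q] := ultra_class_surj (q 0%N).
pose z m := iteri m (fun j s => s + d j) x0.
have zq m : ultra_class U (z m) = q m.
  by elim: m => //= m ih; rewrite ultra_classD ih (dP m).1 addrC subrK.
have zm i m : `|z m.+1 i - z m i| <= 2^-1 ^+ m.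
  rewrite (_ : z m.+1 i = z m i + d m i)// addrAC subrr add0r.
  by apply: le_trans (dP m).2; rewrite ell_infty_normE sup_norm_ub.
have /choice[y yz] i := geometric_cvg (zm i).
have yb : y \in @bounded_families R X I.
  apply/bounded_familiesP; exists (2 + `|z 0%N|) => i.
  rewrite -(subrK (z 0%N i) (y i)); apply: le_trans (ler_normD _ _) _.
  apply: lerD; first by apply: le_trans (yz i 0%N) _; rewrite expr0 mulr1.
  by rewrite ell_infty_normE sup_norm_ub.
exists (ultra_class U (EllInfty yb)) => m.
rewrite -zq -scaleN1r -ultra_classZ -ultra_classD.
apply: ultra_class_norm_near; first by rewrite mulr_ge0// exprn_ge0// invr_ge0.
apply: nearW => i; rewrite (_ : (EllInfty yb + -1 *: z m) i = y i - z m i).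
  exact: yz.
by rewrite -[- z m i]scaleN1r.
Qed.

(** If the limit functional came arbitrarily close to points, points within 2^-m / 4 of it would
    form a Cauchy sequence, and the limit of that sequence would represent the functional. *)
Lemma functional_distance (H : set_system (ultrapower X U)) : ProperFilter H ->
  (forall g : {linear ultrapower X U -> R^o}, unit_functional g ->
     cvg (g x @[x --> H])) ->
  (forall y, exists2 g : {linear ultrapower X U -> R^o}, unit_functional g &
     ~ g x @[x --> H] --> g y) ->
  exists2 th : R, 0 < th & forall y, exists (g : {linear ultrapower X U -> R^o}) (l : R),
    [/\ unit_functional g, g x @[x --> H] --> l & th < `|l - g y|].
Proof.
move=> HF Hc Hn; apply: contrapT => /forall2NP nth.
have /choice[y yP] m : exists y, forall g : {linear ultrapower X U -> R^o},
    unit_functional g -> `|lim (g x @[x --> H]) - g y| <= 2^-1 ^+ m / 4.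
  have h0 : (0 : R) < 2^-1 ^+ m / 4 by rewrite divr_gt0// exprn_gt0// invr_gt0.
  have [/(_ h0)//|/existsNP[y ny]] := nth (2^-1 ^+ m / 4).
  exists y => g g1; rewrite leNgt; apply/negP => h; apply: ny.
  by exists g, (lim (g x @[x --> H])); split=> //; exact: Hc.
have ym m : `|y m.+1 - y m| < 2^-1 ^+ m.
  have h0 : (0 : R) < 2^-1 ^+ m by rewrite exprn_gt0// invr_gt0.
  have [g g1 <-] := norming_functional (y m.+1 - y m).
  have := yP m g g1; have := yP m.+1 g g1; rewrite linearB exprS.
  by rewrite !ler_norml; set h := _ ^+ m in h0 *; set l := lim _; lra.
have [z zy] := ultrapower_geometric_cvg ym; have [g g1] := Hn z; apply.
suff -> : g z = lim (g x @[x --> H]) by exact: Hc.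
apply/eqP; rewrite -subr_eq0 -normr_le0; apply/ler_addgt0Pr => e e0.
rewrite add0r; have e2 : 0 < e / 2 by rewrite divr_gt0.
have [m me] := half_expn_lt e2.
have := yP m g g1; have := g1 (z - y m); rewrite linearB => /le_trans/(_ (zy m)).
rewrite !ler_norml; move: me; set h := _ ^+ m; set l := lim _.
have h0 : 0 <= h by rewrite exprn_ge0// invr_ge0.
by move: h0; lra.
Qed.

End UltrapowerComplete.

(** * Summing sequences *)

Section Generic.
Variables (V : Type) (H : set_system V).
Hypothesis HF : ProperFilter H.

(* [P] holds for [H]-almost every x_0, [H]-almost every x_1, ... *)
Fixpoint generic (n : nat) (P : (nat -> V) -> Prop) : Prop :=
  if n is n'.+1 then
    H [set x | generic n' (fun s => P (fun j => if j is j'.+1 then s j' else x))]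
  else forall s, P s.

Lemma generic_and n (P Q : (nat -> V) -> Prop) :
  generic n P -> generic n Q -> generic n (fun s => P s /\ Q s).
Proof.
elim: n P Q => [|n ih] P Q /=; first by move=> p q s; split.
by apply: filterS2 => x; exact: ih.
Qed.

Lemma generic_sub n (P Q : (nat -> V) -> Prop) :
  (forall s, P s -> Q s) -> generic n P -> generic n Q.
Proof.
elim: n P Q => [|n ih] P Q PQ /=; first by move=> p s; exact: PQ.
by apply: filterS => x; apply: ih => s; exact: PQ.
Qed.

Lemma generic_true n (P : (nat -> V) -> Prop) : (forall s, P s) -> generic n P.
Proof. by elim: n P => //= n ih P Ps; apply: filterE => x; exact: ih. Qed.

Lemma generic_finite n (K : finType) (P : K -> (nat -> V) -> Prop) :
  (forall k, generic n (P k)) -> generic n (fun s => forall k, P k s).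
Proof.
move=> gP; have : generic n (fun s => forall k, k \in enum K -> P k s).
  elim: (enum K) => [|k e ih]; first exact: generic_true.
  apply: generic_sub (generic_and (gP k) ih) => s [Pk Pe] k'.
  by rewrite inE => /orP[/eqP ->|/Pe].
by apply: generic_sub => s + k; apply; rewrite mem_enum.
Qed.

Lemma generic_forall n (B : set V) : H B ->
  generic n (fun s => forall j, (j < n)%N -> B (s j)).
Proof.
move=> HB; elim: n => //= n ih; apply: filterS HB => x Bx.
by apply: generic_sub ih => s Bs [|j]//; exact: Bs.
Qed.

Lemma generic_exists n (P : (nat -> V) -> Prop) : generic n P -> exists s, P s.
Proof.
elim: n P => [|n ih] P /=; last by move=> /filter_ex[x /ih[s Ps]]; eexists; exact: Ps.
have [x _] := filter_ex (@filterT _ H _).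
by move=> /(_ (fun=> x)); exists (fun=> x).
Qed.

End Generic.

Section Summing.
Variables (R : realType) (V : normedModType R) (H : set_system V) (th : R).
Hypothesis HF : ProperFilter H.
Hypothesis farH : forall y, exists (g : {linear V -> R^o}) (l : R),
  [/\ unit_functional g, g x @[x --> H] --> l & th < `|l - g y|].

(** The functional [g] is chosen for the point - y / sg. Once all g (s j) are within [e] of the
    limit l, its value at the sum differs from sg (l - g (- y / sg)) by at most n e. *)
Lemma generic_total_sum (e : R) (y : V) n (c : nat -> R) : 0 < e ->
  (forall j, `|c j| <= 1) ->
  generic H n (fun s => th * `|\sum_(0 <= j < n) c j| - n%:R * e
     <= `|y + \sum_(0 <= j < n) c j *: s j|).
Proof.
move=> e0 c1; set sg := \sum_(0 <= j < n) c j.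
have [sg0|sg0] := eqVneq sg 0.
  apply: (generic_true HF) => s; rewrite sg0 normr0 mulr0 sub0r.
  by rewrite (le_trans _ (normr_ge0 _))// oppr_le0 mulr_ge0// ltW.
have [g [l [g1 gl gy]]] := farH (- sg^-1 *: y).
have Hl : H [set x | `|g x - l| <= e].
  by move/cvgrPdist_le: gl => /(_ e e0); apply: filterS => x; rewrite distrC.
apply: (generic_sub HF _ (generic_forall HF n Hl)) => s /= sl.
apply: le_trans (g1 _); rewrite linearD linear_sum /=.
have -> : g y + \sum_(0 <= j < n) g (c j *: s j) =
    sg * (l - g (- sg^-1 *: y)) + \sum_(0 <= j < n) c j * (g (s j) - l).
  have -> : g (- sg^-1 *: y) = - sg^-1 * g y by rewrite linearZ.
  under eq_bigr do rewrite linearZ.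
  under [in RHS]eq_bigr do rewrite mulrBr.
  by rewrite sumrB -mulr_suml -/sg; set S := \sum_(_ <= _ < _) _; field.
set A := sg * _; set B := \sum_(_ <= _ < _) _.
apply: (le_trans _ (lerB_normD (A : R) (B : R))).
rewrite normrM mulrC; apply: lerB; first by apply: ler_wpM2l => //; exact: ltW.
rewrite {}/B; apply: (le_trans (ler_norm_sum _ _ _)).
apply: (@le_trans _ _ (\sum_(0 <= j < n) e)).
  apply: ler_sum_nat => j /andP[_ jn]; rewrite normrM -[leRHS]mul1r.
  by apply: ler_pM => //; exact: sl.
by rewrite sumr_const_nat subn0 mulr_natl.
Qed.

(** The first [k] terms are absorbed into the arbitrary point [y]; what remains is a total sum. *)
Lemma generic_tail_sum (e : R) (y : V) n k (c : nat -> R) : 0 < e ->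
  (forall j, `|c j| <= 1) -> (k <= n)%N ->
  generic H n (fun s => th * `|\sum_(k <= j < n) c j| - n%:R * e
     <= `|y + \sum_(0 <= j < n) c j *: s j|).
Proof.
move=> e0; elim: k n y c => [|k ih] [|n] y c c1 kn//; try exact: generic_total_sum.
apply: (@filterE _ H) => x.
apply: (generic_sub HF _ (ih n (y + c 0%N *: x) (fun j => c j.+1) _ kn)) => // s.
rewrite big_add1 /= big_nat_recl//= addrA; apply: le_trans.
by apply: lerB => //; apply: ler_wpM2r; [exact: ltW|rewrite ler_nat].
Qed.

Lemma generic_summing n : 0 < th -> generic H n (fun s =>
  forall (b b' : {ffun 'I_n.+1 -> bool}) (k : 'I_n.+1),
    th / 2 * `|\sum_(k <= j < n) ((b (inord j))%:R - (b' (inord j))%:R)|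
    <= `|\sum_(0 <= j < n) ((b (inord j))%:R - (b' (inord j))%:R : R) *: s j|).
Proof.
move=> th0.
suff : generic H n (fun s => forall t : {ffun 'I_n.+1 -> bool} *
    {ffun 'I_n.+1 -> bool} * 'I_n.+1, let: (b, b', k) := t in
    th / 2 * `|\sum_(k <= j < n) ((b (inord j))%:R - (b' (inord j))%:R)|
    <= `|\sum_(0 <= j < n) ((b (inord j))%:R - (b' (inord j))%:R : R) *: s j|).
  by apply: (generic_sub HF) => s h b b' k; exact: (h (b, b', k)).
apply: (generic_finite HF) => -[[b b'] k].
pose c j : R := (b (inord j))%:R - (b' (inord j))%:R.
have c1 j : `|c j| <= 1.
  by rewrite /c; case: (b _); case: (b' _); rewrite ?subrr ?subr0 ?sub0r ?normrN ?normr0 ?normr1.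
(* The error n e is then at most th / 2. A nonzero tail sum is an integer, hence at least 1 in
   absolute value, so half of the main term absorbs the error. *)
have e0 : 0 < th / 2 / n.+1%:R by rewrite !divr_gt0.
have kn : (k <= n)%N by rewrite -ltnS.
apply: (generic_sub HF _ (generic_tail_sum 0 e0 c1 kn)) => s; rewrite add0r.
have [z zE] : exists z : int, \sum_(k <= j < n) c j = z%:~R.
  exists (\sum_(k <= j < n) ((b (inord j))%:Z - (b' (inord j))%:Z)).
  by rewrite rmorph_sum /=; apply: eq_bigr => j _; rewrite rmorphB.
have ne : n%:R * (th / 2 / n.+1%:R) <= th / 2.
  by rewrite mulrA ler_pdivrMr// mulrC ler_pM2l ?divr_gt0// ler_nat.
rewrite -/c (_ : \sum_(k <= j < n) ((b (inord j))%:R - (b' (inord j))%:R) = z%:~R)//.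
rewrite ?zE; have [->|z0] := eqVneq z 0.
  by move=> _; rewrite mulr0z normr0 mulr0.
apply: le_trans; have : th / 2 * 1 <= th / 2 * `|z%:~R : R|.
  by rewrite ler_pM2l ?divr_gt0// -intr_norm ler1z -gtz0_ge1 normr_gt0.
by move: ne; set u := n%:R * _; set v := `|_|; lra.
Qed.

End Summing.

Lemma ultra_norm_gt (R : realType) (X : completeNormedModType R) (I : Type)
    (U : free_ultrafilter I) (x : ell_infty X I) (r : R) :
  0 <= r -> r < `|ultra_class U x| -> \forall i \near (U : set_system I), r <= `|x i|.
Proof.
move=> r0 xr; have UF := free_ultrafilter_ultra U.
have [h|h] := in_ultra_setVsetC [set i | `|x i| <= r] UF.
  by have := lt_le_trans xr (ultra_class_norm_near r0 h); rewrite ltxx.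
by apply: filterS h => i /= /negP; rewrite -ltNge => /ltW.
Qed.

Lemma ultra_class_sum (R : realType) (X : normedModType R) (I : Type)
    (U : free_ultrafilter I) n (c : nat -> R) (x : nat -> ell_infty X I) :
  ultra_class U (\sum_(0 <= j < n) c j *: x j) =
  \sum_(0 <= j < n) c j *: ultra_class U (x j).
Proof.
elim: n => [|n ih].
  by rewrite !big_geq//; exact: raddf0.
by rewrite !big_nat_recr//= ultra_classD ultra_classZ ih.
Qed.

Lemma family_sum (R : realType) (X : normedModType R) (I : Type)
    n (c : nat -> R) (x : nat -> ell_infty X I) i :
  (\sum_(0 <= j < n) c j *: x j : ell_infty X I) i =
  \sum_(0 <= j < n) c j *: x j i.
Proof.
elim: n => [|n ih]; first by rewrite !big_geq.
by rewrite !big_nat_recr//= -ih.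
Qed.

(** The lower bound by tail sums known from the summing basis, for coefficients in {-1, 0, 1}; they
    appear as differences of bits because they will come from two coded vertices. *)
Definition summing (R : realType) (X : normedModType R) (th : R) (n : nat)
    (x : nat -> X) : Prop :=
  forall (b b' : nat -> bool) k, (k <= n)%N ->
    th * `|\sum_(k <= j < n) ((b j)%:R - (b' j)%:R)|
    <= `|\sum_(0 <= j < n) ((b j)%:R - (b' j)%:R : R) *: x j|.

Lemma not_super_weakly_compact_summing (R : realType)
    (X : completeNormedModType R) (L : set X) :
  bounded_set L -> ~ relatively_super_weakly_compact L ->
  exists2 th : R, 0 < th &
    forall n, exists2 x : nat -> X, forall j, (j < n)%N -> L (x j) & summing th n x.
Proof.
move=> Lb /existsNP[I /existsNP[U /not_implyP[_]]].
have UF := free_ultrafilter_ultra U; have [M M0 LM] := bounded_setP Lb.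
have bA : bounded_set (ultra_set U L).
  exists M; split; first exact: num_real.
  move=> N MN _ [x Lx <-]; apply: le_trans (ltW MN).
  by apply: ultra_class_norm_near; [exact: ltW|apply: nearW => i; exact: LM].
move=> /(not_weakly_compact_filter bA)[H [HF HA Hc Hn]].
have [th th0 thP] := functional_distance HF Hc Hn.
have th4 : 0 < th / 4 by rewrite divr_gt0.
(* Halving th / 2 makes the inequalities with a nonzero tail strict. Finitely many strict
   inequalities hold on almost all coordinates, and one such coordinate gives the points of [L]. *)
exists (th / 4) => // n.
have gA := generic_forall HF n HA.
have [s [sA sP]] := generic_exists HF (generic_and HF gA (generic_summing HF thP n th0)).
have /choice[x xP] j : exists x : ell_infty X I, (j < n)%N ->
    (forall i, L (x i)) /\ ultra_class U x = s j.
  by have [/sA[x Lx xs]|] := ltnP j n; [exists x|exists 0].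
pose P i (t : {ffun 'I_n.+1 -> bool} * {ffun 'I_n.+1 -> bool} * 'I_n.+1) :=
  let: (b, b', k) := t in
    th / 4 * `|\sum_(k <= j < n) ((b (inord j))%:R - (b' (inord j))%:R)|
    <= `|\sum_(0 <= j < n) ((b (inord j))%:R - (b' (inord j))%:R : R) *: x j i|.
have : \forall i \near (U : set_system I), forall t, P i t.
  suff : \forall i \near (U : set_system I), forall t, t \in enum {: _} -> P i t.
    by apply: filterS => i + t; apply; rewrite mem_enum.
  elim: (enum _) => [|[[b b'] k] e ih]; first exact: nearW.
  suff : \forall i \near (U : set_system I), P i (b, b', k).
    apply: filterS2 ih => i ihi Pi t; rewrite inE => /orP[/eqP ->//|]; exact: ihi.
  pose c j : R := (b (inord j))%:R - (b' (inord j))%:R.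
  suff : \forall i \near (U : set_system I), th / 4 * `|\sum_(k <= j < n) c j| <=
      `|(\sum_(0 <= j < n) c j *: x j : ell_infty X I) i|.
    by apply: filterS => i; rewrite family_sum.
  have [->|c0] := eqVneq (\sum_(k <= j < n) c j) 0.
    by apply: nearW => i; rewrite normr0 mulr0.
  apply: ultra_norm_gt; first by rewrite mulr_ge0// ltW.
  rewrite ultra_class_sum.
  rewrite (_ : \sum_(0 <= j < n) _ = \sum_(0 <= j < n) c j *: s j).
    apply: lt_le_trans (sP b b' k); rewrite ltr_pM2r ?normr_gt0//.
    by lra.
  by apply: eq_big_nat => j /andP[_ /xP[_ ->]].
move=> /filter_ex[i iP]; exists (fun j => x j i).
  by move=> j /xP[+ _]; exact.
move=> b b' k kn.
pose f (b : nat -> bool) : {ffun 'I_n.+1 -> bool} := [ffun j : 'I_n.+1 => b j].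
have fE (a : nat -> bool) j : (j < n)%N -> f a (inord j) = a j.
  by move=> jn; rewrite ffunE inordK// ltnS ltnW.
have := iP (f b, f b', inord k); rewrite /P inordK ?ltnS//.
rewrite (eq_big_nat _ _ (F2 := fun j => (b j)%:R - (b' j)%:R)); last first.
  by move=> j /andP[_ jn]; rewrite !fE.
rewrite [in X in _ <= X -> _](eq_big_nat _ _
  (F2 := fun j => ((b j)%:R - (b' j)%:R) *: x j i))//.
by move=> j /andP[_ jn]; rewrite !fE.
Qed.

(** * Codings of graphs *)

Section Counting.

Definition cnt (k l : nat) (b : nat -> bool) : nat := \sum_(k <= j < l) b j.

(** An absolute difference: at least one of the truncated subtractions is 0. *)
Definition dev (k l : nat) (b b' : nat -> bool) : nat :=
  (cnt k l b - cnt k l b') + (cnt k l b' - cnt k l b).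

Definition hamming (n : nat) (b b' : nat -> bool) : nat :=
  \sum_(0 <= j < n) (b j (+) b' j).

Lemma cnt_cat k l m b : (k <= l <= m)%N -> cnt k m b = (cnt k l b + cnt l m b)%N.
Proof. by move=> /andP[kl lm]; rewrite /cnt (big_cat_nat kl lm). Qed.

Lemma eq_cnt k l b b' : (forall j, (k <= j < l)%N -> b j = b' j) ->
  cnt k l b = cnt k l b'.
Proof. by move=> bb'; apply: eq_big_nat => j /bb' ->. Qed.

Lemma cnt_const k l (c : bool) : cnt k l (fun=> c) = (c * (l - k))%N.
Proof. by rewrite /cnt sum_nat_const_nat mulnC. Qed.

Lemma cnt_le k l b : (cnt k l b <= l - k)%N.
Proof.
by rewrite -[leqRHS]mul1n -(cnt_const k l true); apply: leq_sum => j _; case: (b j).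
Qed.

Lemma cnt_neg k l b : (cnt k l (fun j => ~~ b j) + cnt k l b)%N = (l - k)%N.
Proof.
rewrite /cnt -big_split /= -[RHS]mul1n -(cnt_const k l true).
by apply: eq_bigr => j _; case: (b j).
Qed.

Lemma cnt_addb s k l b :
  cnt k l (fun j => s (+) b j) = if s then (l - k - cnt k l b)%N else cnt k l b.
Proof.
case: s; last exact: eq_cnt.
rewrite -(cnt_neg k l b) addnK; exact: eq_cnt.
Qed.

Lemma dev_addb s k l b b' :
  dev k l (fun j => s (+) b j) (fun j => s (+) b' j) = dev k l b b'.
Proof.
rewrite /dev !cnt_addb; case: s => //.
by have := cnt_le k l b; have := cnt_le k l b'; lia.
Qed.

Lemma dev_hamming k l n b b' : (l <= n)%N -> (dev k l b b' <= hamming n b b')%N.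
Proof.
move=> ln; have [kl|lk] := leqP k l; last first.
  by rewrite /dev /cnt !big_geq ?(ltnW lk).
apply: (@leq_trans (\sum_(k <= j < l) (b j (+) b' j))%N).
  rewrite /dev; suff h (c c' : nat -> bool) :
      (cnt k l c <= cnt k l c' + \sum_(k <= j < l) (c j (+) c' j))%N.
    have e : (\sum_(k <= j < l) (b' j (+) b j) = \sum_(k <= j < l) (b j (+) b' j))%N.
      by apply: eq_bigr => j _; rewrite addbC.
    by have := h b b'; have := h b' b; rewrite e; lia.
  by rewrite /cnt -big_split; apply: leq_sum => j _; case: (c j); case: (c' j).
rewrite /hamming (big_cat_nat (leq0n k) (leq_trans kl ln)) (big_cat_nat kl ln) /=.
exact: leq_trans (leq_addr _ _) (leq_addl _ _).
Qed.

Lemma hamming_triangle n b b' b'' :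
  (hamming n b b'' <= hamming n b b' + hamming n b' b'')%N.
Proof.
rewrite /hamming -big_split; apply: leq_sum => j _.
by case: (b j); case: (b' j); case: (b'' j).
Qed.

Lemma hamming_le1 n (b b' : nat -> bool) q : (forall j, j != q -> b j = b' j) ->
  (hamming n b b' <= 1)%N.
Proof.
move=> bb'; rewrite /hamming big_mkord.
have [qn|nq] := ltnP q n.
  rewrite (bigD1 (Ordinal qn)) //= big1 ?addn0 ?leq_b1// => j jq.
  by rewrite bb' ?addbb.
by rewrite big1// => j _; rewrite bb' ?addbb// ltn_eqF// (leq_trans (ltn_ord j)).
Qed.

End Counting.

(** * Graph distance, codings and the maps they define *)

Section GraphDistance.
Variable G : graph.
Implicit Types x y z : vertex G.

Lemma graph_dist_refl x : graph_dist x x = 0%N.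
Proof.
apply/eqP; rewrite -leqn0; apply: graph_dist_leP; apply/walk_of_lengthP.
by exists [::].
Qed.

Lemma graph_dist_sym x y : graph_dist x y = graph_dist y x.
Proof. by apply: eq_find => n; apply/idP/idP; exact: walk_sym. Qed.

Lemma graph_dist_triangle y x z :
  (graph_dist x z <= graph_dist x y + graph_dist y z)%N.
Proof.
have [xyG|Gxy] := ltnP (graph_dist x y) #|vertex G|; last first.
  exact: leq_trans (graph_dist_le _ _) (leq_trans Gxy (leq_addr _ _)).
have [yzG|Gyz] := ltnP (graph_dist y z) #|vertex G|; last first.
  exact: leq_trans (graph_dist_le _ _) (leq_trans Gyz (leq_addl _ _)).
by apply: graph_dist_leP; apply: walk_cat; exact: graph_dist_walk.
Qed.

Lemma graph_dist_adj x y : graph_adj x y -> (graph_dist x y <= 1)%N.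
Proof.
move=> xy; apply: graph_dist_leP; apply/walk_of_lengthP.
by exists [:: y]; rewrite /= xy.
Qed.

(* A coding of the vertices by bit vectors which compares the graph distance
   with the norm given by the sums over intervals of indices. *)
Record coding (n : nat) (phi : vertex G -> nat -> bool) : Prop := Coding {
  coding_adj : forall l x y, graph_adj x y -> (hamming l (phi x) (phi y) <= 1)%N;
  coding_dist : forall x y, exists k l, (k <= l <= n)%N /\
    (graph_dist x y <= 2 * dev k l (phi x) (phi y))%N }.

Variables (n : nat) (phi : vertex G -> nat -> bool).
Hypothesis phiP : coding n phi.
Hypothesis Gconn : forall x y, connect (@graph_adj G) x y.

Lemma hamming_graph_dist l x y : (hamming l (phi x) (phi y) <= graph_dist x y)%N.
Proof.
have /walk_of_lengthP[p [xp <- <-]] := graph_distP (Gconn x y).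
elim: p x xp => [|z p ih] x /=.
  by move=> _; rewrite /hamming big1// => j _; rewrite addbb.
move=> /andP[xz zp]; apply: leq_trans (hamming_triangle _ _ (phi z) _) _.
by rewrite -add1n leq_add ?ih// (coding_adj phiP).
Qed.

Section Transfer.
Variables (R : realType) (X : normedModType R) (L : set X).
Local Notation M := (graph_space R G).

(** An interval sum is a difference of two tails, which costs a factor 2; the factor 2 in the coding
    gives th / 4. In a difference quotient the absolute values of the coefficients add up to the
    Hamming distance over the graph distance, which is at most 1. *)
Lemma coding_map (th : R) (x : nat -> X) : 0 < th ->
  (forall j, (j < n)%N -> L (x j)) ->
  summing th n x ->
  exists f : M -> X, theta_separated (th / 4) f /\ ave f `<=` closed_absconvex_hull L.
Proof.
move=> th0 Lx xth; pose f (s : M) := \sum_(0 <= j < n) (phi s j)%:R *: x j.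
have fB s t : f s - f t = \sum_(0 <= j < n) ((phi s j)%:R - (phi t j)%:R : R) *: x j.
  by rewrite /f -sumrB; apply: eq_bigr => j _; rewrite scalerBl.
have sumB k l (b b' : nat -> bool) :
    \sum_(k <= j < l) ((b j)%:R - (b' j)%:R) = (cnt k l b)%:R - (cnt k l b')%:R :> R.
  by rewrite sumrB /cnt !natr_sum.
exists f; split=> [s t|_ [s [t [st ->]]]].
  have [k [l [/andP[kl ln] dkl]]] := coding_dist phiP s t.
  have := xth (phi s) (phi t) k (leq_trans kl ln).
  have := xth (phi s) (phi t) l ln; rewrite -fB (big_cat_nat kl ln) /=.
  rewrite !sumB graph_space_mdistE.
  set N := `|f s - f t|; set u := _ - _; set v := _ - _ => hu huv.
  have vN : th * `|v| <= 2 * N.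
    have := ler_normB (v + u) u; rewrite addrK => /(ler_wpM2l (ltW th0)).
    by rewrite mulrDr; move: hu huv; lra.
  have dv : (graph_dist s t)%:R <= 2 * `|v|.
    apply: le_trans (_ : (2 * dev k l (phi s) (phi t))%:R <= _); first by rewrite ler_nat.
    rewrite natrM ler_pM2l// /dev /v.
    have [h|/ltnW h] := leqP (cnt k l (phi s)) (cnt k l (phi t)).
      move: (h) => /eqP ->; rewrite add0n natrB// ler_normr.
      by rewrite opprB lexx orbT.
    by move: (h) => /eqP ->; rewrite addn0 natrB// ler_norm.
  have := ler_wpM2l (ltW th0) dv; move: vN.
  rewrite [th * (2 * _)]mulrCA; set w := `|v|; set z := _%:R; lra.
have d0 : (0 < graph_dist s t)%N.
  have : mdist s t != 0 by apply: contra st => /eqP/mdist_positivity ->.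
  by rewrite graph_space_mdistE pnatr_eq0 lt0n.
apply: subset_closure; rewrite graph_space_mdistE fB.
exists n, (fun i => (graph_dist s t)%:R^-1 * ((phi s i)%:R - (phi t i)%:R)), (fun i => x i).
split.
- by move=> i; exact: Lx.
- under eq_bigr do rewrite normrM normfV normr_nat.
  rewrite -mulr_sumr ler_pdivrMl ?ltr0n// mulr1.
  apply: le_trans (_ : (hamming n (phi s) (phi t))%:R <= _); last first.
    by rewrite ler_nat hamming_graph_dist.
  rewrite /hamming big_mkord natr_sum; apply: ler_sum => i _.
  by case: (phi s i); case: (phi t i); rewrite ?subrr ?subr0 ?sub0r ?normrN ?normr0 ?normr1.
- by rewrite scaler_sumr big_mkord; apply: eq_bigr => i _; rewrite scalerA.
Qed.

Variables (theta : R) (f : M -> X).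
Hypotheses (theta0 : 0 < theta) (fsep : theta_separated theta f).
Hypothesis fave : ave f `<=` closed_absconvex_hull L.

Lemma separated_adj x y : graph_adj x y -> x != y -> bipolar L (f x - f y).
Proof.
move=> xy nxy; apply: closed_absconvex_hull_bipolar; apply: fave.
exists x, y; split => //; rewrite graph_space_mdistE.
have /eqP -> : graph_dist x y == 1%N; last by rewrite invr1 scale1r.
rewrite eqn_leq graph_dist_adj//= lt0n; apply: contra nxy => /eqP d0.
have : mdist (x : M) y = 0 by rewrite graph_space_mdistE d0.
by move=> /mdist_positivity ->.
Qed.

Lemma separated_dev k l x y :
  theta * (dev k l (phi x) (phi y))%:R <= `|f x - f y|.
Proof.
apply: le_trans (fsep x y); rewrite ler_pM2l// graph_space_mdistE.
by rewrite ler_nat (leq_trans (dev_hamming _ _ _ (leqnn l)))// hamming_graph_dist.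
Qed.

End Transfer.
End GraphDistance.

(** * Replacing edges by gadgets *)

Section Gadgets.
Variables (k m : nat) (H : gadget k).
Hypothesis m0 : (0 < m)%N.

Local Notation slot := (bool + 'I_k)%type.

Definition gadget_src (j : 'I_(size H)) : slot := (tnth (in_tuple H) j).1.
Definition gadget_dst (j : 'I_(size H)) : slot := (tnth (in_tuple H) j).2.

(* An edge replaced by the gadget is cut into [m] blocks. The vertex [w] is
   coded by the set [P w] of the blocks lying between [u] and [w]; the two ends
   of the [j]-th edge differ by the block [blk j], which belongs to the source
   when [rv j]. *)
Variables (P : slot -> nat -> bool) (blk : 'I_(size H) -> nat)
  (rv : 'I_(size H) -> bool).

Definition gadget_consistent : Prop :=
  [/\ forall i, P (inl false) i = false, forall i, P (inl true) i = true
    & forall j, [/\ (blk j < m)%N, P (gadget_src j) (blk j) = rv j,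
        P (gadget_dst j) (blk j) = ~~ rv j
      & forall i, (i < m)%N -> i != blk j -> P (gadget_src j) i = P (gadget_dst j) i]].

Definition gadget_covered : Prop :=
  forall w, exists j, w = gadget_src j \/ w = gadget_dst j.

(** The number of ones in block [i] for a vertex grown from the [j]-th gadget edge at height [A]
    over its source: only block [blk j] depends on [A]. *)
Definition block_height (h : nat) (j : 'I_(size H)) (A i : nat) : nat :=
  if i == blk j then (if rv j then (h - A)%N else A) else (P (gadget_src j) i * h)%N.

(** The inductive step for distances, for an abstract [d] with triangle inequality: [h] bounds the
    length of a part grown from a gadget edge, [x] lies at height [A] in such a part, and the
    conclusions are the same estimates one level up. *)
Definition gadget_metric : Prop :=
  forall (T : Type) (d : T -> T -> nat) (h : nat) (z : slot -> T),
  (forall x, d x x = 0%N) -> (forall x y, d x y = d y x) ->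
  (forall x y t, d x t <= d x y + d y t)%N ->
  (forall j, d (z (gadget_src j)) (z (gadget_dst j)) <= h)%N ->
  forall j x A, (A <= h)%N -> (d (z (gadget_src j)) x <= A)%N ->
    (d x (z (gadget_dst j)) <= h - A)%N ->
  [/\ (d (z (inl false)) x <= \sum_(0 <= i < m) block_height h j A i)%N,
      (d x (z (inl true)) <= m * h - \sum_(0 <= i < m) block_height h j A i)%N
    & forall j' y B, j != j' -> (B <= h)%N -> (d (z (gadget_src j')) y <= B)%N ->
        (d y (z (gadget_dst j')) <= h - B)%N ->
      exists i1 i2, (i1 <= i2 <= m)%N /\
        let s := (\sum_(i1 <= i < i2) block_height h j A i)%N in
        let t := (\sum_(i1 <= i < i2) block_height h j' B i)%N in
        (d x y <= 2 * ((s - t) + (t - s)))%N].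

Hypothesis Hcons : gadget_consistent.
Hypothesis Hcov : gadget_covered.

Local Notation Rep := (replace_edges H).

(** The first replacement is peeled off first, unlike in [iter], so that induction descends from an
    edge of [G] into the gadget replacing it. *)
Fixpoint iter_replace (N : nat) (G : edge_graph) : edge_graph :=
  if N is N'.+1 then iter_replace N' (Rep G) else G.

Lemma iter_replaceE N G : iter_replace N G = iter N Rep G.
Proof. by elim: N G => //= N ih G; rewrite ih -iterSr. Qed.

Fixpoint old_node (N : nat) (G : edge_graph) : node G -> node (iter_replace N G) :=
  if N is N'.+1 then fun x => @old_node N' (Rep G) (inl x) else id.

(* Each edge of a coded graph flips the single bit [lab e] of the code. *)
Record code (G : edge_graph) := Code {
  pot : node G -> nat -> bool; lab : edge G -> nat; sgn : edge G -> bool }.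

Definition consistent G (c : code G) : Prop := forall e : edge G,
  [/\ pot c (edge_ends e).1 (lab c e) = sgn c e,
      pot c (edge_ends e).2 (lab c e) = ~~ sgn c e
    & forall p, p != lab c e -> pot c (edge_ends e).1 p = pot c (edge_ends e).2 p].

(** Each old bit becomes a block of [m] bits. The block labelled by [e] receives the pattern of the
    slot, complemented according to [sgn c e]; the other blocks repeat the old bit. *)
Definition slot_code G (c : code G) (e : edge G) (w : slot) (p : nat) : bool :=
  if (p %/ m)%N == lab c e then sgn c e (+) P w (p %% m)%N
  else pot c (edge_ends e).1 (p %/ m)%N.

Definition replace_code G (c : code G) : code (Rep G) :=
  @Code (Rep G)
    (fun x p => match x with
                | inl y => pot c y (p %/ m)%N
                | inr ei => slot_code c ei.1 (inr ei.2) p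
                end)
    (fun ej => (m * lab c ej.1 + blk ej.2)%N)
    (fun ej => sgn c ej.1 (+) rv ej.2).

Fixpoint iter_code N G (c : code G) : code (iter_replace N G) :=
  if N is N'.+1 then iter_code N' (replace_code c) else c.

Lemma pot_gadget_node G (c : code G) e w p : consistent c ->
  pot (replace_code c) (gadget_node e w) p = slot_code c e w p.
Proof.
move=> cc; have [h1 h2 h3] := cc e; have [P0 P1 _] := Hcons.
case: w => [[]|i] //=; rewrite /slot_code.
  case: eqP => [->|/eqP pl]; first by rewrite h2 P1 addbT.
  by rewrite h3.
by case: eqP => [->|//]; rewrite P0 addbF h1.
Qed.

Lemma divn_block a b : (b < m)%N -> ((m * a + b) %/ m)%N = a.
Proof. by move=> bm; rewrite mulnC divnMDl// divn_small// addn0. Qed.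

Lemma modn_block a b : (b < m)%N -> ((m * a + b) %% m)%N = b.
Proof. by move=> bm; rewrite mulnC modnMDl modn_small. Qed.

Lemma replace_code_consistent G (c : code G) : consistent c ->
  consistent (replace_code c).
Proof.
move=> cc [e j]; have [_ _ /(_ j)[bm Ps Pd Pi]] := Hcons.
rewrite [edge_ends _]/= -/(gadget_src j) -/(gadget_dst j).
rewrite !pot_gadget_node//.
have b1 := divn_block (lab c e) bm; have b2 := modn_block (lab c e) bm.
split=> [||p pne]; rewrite ?pot_gadget_node// /slot_code /=.
- by rewrite b1 b2 eqxx Ps.
- by rewrite b1 b2 eqxx Pd addbN.
case: eqP => // pl; rewrite Pi// ?ltn_pmod//.
by apply: contra pne => /eqP pb; rewrite /= -pb -pl mulnC -divn_eq.
Qed.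

Lemma iter_code_consistent N G (c : code G) : consistent c ->
  consistent (iter_code N c).
Proof.
by elim: N G c => //= N ih G c cc; apply: ih; exact: replace_code_consistent.
Qed.

Lemma iter_code_old N G (c : code G) x p :
  pot (iter_code N c) (old_node N x) p = pot c x (p %/ m ^ N)%N.
Proof.
elim: N G c x p => [|N ih] G c x p /=; first by rewrite expn0 divn1.
by rewrite ih /= expnSr divnMA.
Qed.

Fixpoint inside (N : nat) (G : edge_graph) (e : edge G) :
    node (iter_replace N G) -> Prop :=
  if N is N'.+1 then fun x => exists j : 'I_(size H), @inside N' (Rep G) (e, j) x
  else fun x => x = (edge_ends e).1 \/ x = (edge_ends e).2.

Definition covered (G : edge_graph) : Prop :=
  forall x : node G, exists e, x = (edge_ends e).1 \/ x = (edge_ends e).2.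

Lemma replace_covered G : covered G -> covered (Rep G).
Proof.
move=> Gc; have slot_covered (e : edge G) w : exists e',
    gadget_node e w = (@edge_ends (Rep G) e').1 \/
    gadget_node e w = (@edge_ends (Rep G) e').2.
  by have [j [->|->]] := Hcov w; exists (e, j); [left|right].
case=> [x|[e i]]; last exact: (slot_covered e (inr i)).
have [e [->|->]] := Gc x; first exact: (slot_covered e (inl false)).
exact: (slot_covered e (inl true)).
Qed.

Lemma inside_covered N G : covered G -> forall x, exists e, @inside N G e x.
Proof.
elim: N G => [|N ih] G Gc x /=; first exact: Gc.
have [[e j] xej] := ih _ (replace_covered Gc) x; by exists e, j.
Qed.

Lemma inside_nonempty N G (e : edge G) : exists x, @inside N G e x.
Proof.
elim: N G e => [|N ih] G e /=; first by exists (edge_ends e).1; left.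
have [j _] := Hcov (inl false).
by have [x xj] := ih (Rep G) (e, j); exists x, j.
Qed.

(** Replacements inside [e] refine only the block labelled by [e]; elsewhere the bits are those of
    its ends. *)
Lemma inside_code N G (c : code G) (e : edge G) x p : consistent c ->
  inside e x -> (p %/ m ^ N)%N != lab c e ->
  pot (iter_code N c) x p = pot c (edge_ends e).1 (p %/ m ^ N)%N.
Proof.
elim: N G c e x p => [|N ih] G c e x p cc /=.
  rewrite expn0 divn1 => -[->//|-> ple].
  by have [_ _ ->] := cc e.
move=> [j xj] ple; have [_ _ /(_ j)[bm _ _ _]] := Hcons.
have pE : (p %/ m ^ N.+1)%N = (p %/ m ^ N %/ m)%N by rewrite expnSr divnMA.
have cc' := replace_code_consistent cc.
rewrite (ih _ _ _ _ _ cc' xj); last first.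
  by apply: contra ple => /eqP; rewrite pE => ->; rewrite /= divn_block.
rewrite [edge_ends _]/= -/(gadget_src j) pot_gadget_node// /slot_code pE.
by rewrite -pE (negPf ple).
Qed.

Lemma big_blocks h q i1 i2 F : (i1 <= i2)%N ->
  cnt ((q + i1) * h) ((q + i2) * h) F =
  (\sum_(i1 <= i < i2) cnt ((q + i) * h) ((q + i).+1 * h) F)%N.
Proof.
elim: i2 => [|i2 ih].
  by rewrite leqn0 => /eqP ->; rewrite big_geq// /cnt big_geq.
rewrite leq_eqVlt => /orP[/eqP ->|i12]; first by rewrite big_geq// /cnt big_geq.
rewrite big_nat_recr//= -ih// addnS (@cnt_cat _ ((q + i2) * h))//.
by rewrite !leq_mul2r !leq_add2l -ltnS i12 ?orbT//= leqnSn orbT.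
Qed.

Section Heights.
Hypothesis Hmet : gadget_metric.

(** After correction by the sign, the number of ones in the block of [e] is the height of a vertex
    over the source of [e]. The map [iota] into a fixed graph keeps the final metric throughout the
    induction on [N]. *)
Lemma inside_heights N G (c : code G) (Gam : graph)
    (iota : node (iter_replace N G) -> vertex Gam) (e : edge G) :
  consistent c ->
  (forall e' : edge (iter_replace N G),
     graph_dist (iota (edge_ends e').1) (iota (edge_ends e').2) <= 1)%N ->
  let h := (m ^ N)%N in let q := lab c e in
  let S x p := sgn c e (+) pot (iter_code N c) x p in
  (forall x, inside e x ->
    graph_dist (iota (old_node N (edge_ends e).1)) (iota x)
       <= cnt (q * h) (q.+1 * h) (S x) /\
    graph_dist (iota x) (iota (old_node N (edge_ends e).2))
       <= h - cnt (q * h) (q.+1 * h) (S x))%N /\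
  (forall x y, inside e x -> inside e y -> exists k l,
    (q * h <= k <= l)%N /\ (l <= q.+1 * h)%N /\
    (graph_dist (iota x) (iota y) <= 2 * dev k l (S x) (S y))%N).
Proof.
move=> + + h q S; rewrite {}/h {}/q.
elim: N G c iota e @S => [|N ih] G c iota e S cc edges.
  have [c1 c2 _] := cc e.
  have S1 : cnt (lab c e * m ^ 0) ((lab c e).+1 * m ^ 0) (S (edge_ends e).1) = 0%N.
    by rewrite /cnt expn0 !muln1 big_nat1 /S /= c1 addbb.
  have S2 : cnt (lab c e * m ^ 0) ((lab c e).+1 * m ^ 0) (S (edge_ends e).2) = 1%N.
    by rewrite /cnt expn0 !muln1 big_nat1 /S /= c2 addbN addbb.
  have d1 := edges e.
  split=> [x [->|->]|x y xe ye] /=.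
  - by rewrite S1 graph_dist_refl.
  - by rewrite S2 graph_dist_refl.
  - exists (lab c e * m ^ 0)%N, ((lab c e).+1 * m ^ 0)%N; split.
      by rewrite leqnn leq_mul2r leqnSn orbT.
    split=> //; rewrite /dev; case: xe ye => -> [] ->.
    + by rewrite graph_dist_refl.
    + by rewrite S1 S2 (leq_trans d1).
    + by rewrite S1 S2 graph_dist_sym (leq_trans d1).
    + by rewrite graph_dist_refl.
have cc' := replace_code_consistent cc.
set h := (m ^ N)%N; set q := lab c e.
pose c' := replace_code c.
have {}ih j := ih _ c' iota (e, j) cc' edges.
pose B j x := cnt ((m * q + blk j) * h) ((m * q + blk j).+1 * h)
  (fun p => (sgn c e (+) rv j) (+) pot (iter_code N c') x p).
have Bh j x : (B j x <= h)%N.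
  by apply: leq_trans (cnt_le _ _ _) _; rewrite -mulnBl subSn// subnn mul1n.
(* Adding [rv j] passes from the orientation of the gadget edge to that of [e]; outside [blk j] the
   code is constant on each block. *)
have SE j x i : @inside N (Rep G) (e, j) x -> (i < m)%N ->
    cnt ((m * q + i) * h) ((m * q + i).+1 * h) (S x) = block_height h j (B j x) i.
  move=> xj im; rewrite /block_height; case: eqP => [->|/eqP ij].
    have -> : cnt ((m * q + blk j) * h) ((m * q + blk j).+1 * h) (S x) =
        cnt ((m * q + blk j) * h) ((m * q + blk j).+1 * h)
          (fun p => rv j (+) ((sgn c e (+) rv j) (+) pot (iter_code N c') x p)).
      by apply: eq_cnt => p _; rewrite addbA [rv j (+) _]addbC addbK.
    by rewrite cnt_addb -mulnBl subSn// subnn mul1n.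
  transitivity (P (gadget_src j) i * ((m * q + i).+1 * h - (m * q + i) * h))%N.
    rewrite -cnt_const; apply: eq_cnt => p /andP[p1 p2].
    have h0 : (0 < h)%N by rewrite expn_gt0 m0.
    have pE : (p %/ h)%N = (m * q + i)%N.
      by apply/eqP; rewrite eqn_leq leq_divRL// p1 -ltnS ltn_divLR// p2.
    rewrite /S /= (inside_code cc' xj) pE; last first.
      by rewrite /= eqn_add2l.
    rewrite [edge_ends _]/= -/(gadget_src j) pot_gadget_node// /slot_code.
    by rewrite divn_block// modn_block// eqxx addbA addbb addFb.
  by rewrite -mulnBl subSn// subnn mul1n.
have sumE j x i1 i2 : @inside N (Rep G) (e, j) x -> (i1 <= i2 <= m)%N ->
    cnt ((m * q + i1) * h) ((m * q + i2) * h) (S x) =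
    (\sum_(i1 <= i < i2) block_height h j (B j x) i)%N.
  move=> xj /andP[i12 i2m]; rewrite big_blocks//; apply: eq_big_nat => i /andP[_ ii].
  by apply: SE => //; exact: leq_trans i2m.
have hE : (m ^ N.+1)%N = (m * h)%N by rewrite expnS.
have qE : (q * m ^ N.+1)%N = ((m * q + 0) * h)%N.
  by rewrite hE addn0 mulnA (mulnC q).
have qE1 : (q.+1 * m ^ N.+1)%N = ((m * q + m) * h)%N.
  by rewrite hE mulnA mulSn addnC (mulnC q).
pose z w := iota (@old_node N (Rep G) (gadget_node e w)).
have B1 j x : @inside N (Rep G) (e, j) x ->
    (graph_dist (z (gadget_src j)) (iota x) <= B j x)%N /\
    (graph_dist (iota x) (z (gadget_dst j)) <= h - B j x)%N.
  by move=> xj; have [/(_ x xj)] := ih j.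
have zedge j : (graph_dist (z (gadget_src j)) (z (gadget_dst j)) <= h)%N.
  have [x xj] := @inside_nonempty N (Rep G) (e, j); have [b1 b2] := B1 j x xj.
  apply: leq_trans (graph_dist_triangle (iota x) _ _) _.
  by have := Bh j x; lia.
have met := Hmet (@graph_dist_refl Gam) (@graph_dist_sym Gam)
  (fun x y t => graph_dist_triangle y x t) zedge.
rewrite qE qE1; split=> [x [j xj]|x y [j xj] [j' yj]].
  have [b1 b2] := B1 j x xj.
  have [r1 r2 _] := met j (iota x) (B j x) (Bh j x) b1 b2.
  by rewrite (sumE j)// ?leqnn// hE; split.
have [b1 b2] := B1 j x xj.
have [r1 r2 r3] := met j (iota x) (B j x) (Bh j x) b1 b2.
(* Vertices from different gadget edges are compared by the gadget condition, those from the same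
   one by induction. *)
have [jj|jj] := eqVneq j j'; last first.
  have [b1' b2'] := B1 j' y yj.
  have [i1 [i2 [i12 r]]] := r3 j' (iota y) (B j' y) jj (Bh j' y) b1' b2'.
  have /andP[i12' i2m] := i12.
  exists ((m * q + i1) * h)%N, ((m * q + i2) * h)%N; split.
    by rewrite !leq_mul2r !leq_add2l leq0n i12' !orbT.
  split; first by rewrite leq_mul2r leq_add2l i2m orbT.
  by rewrite /dev (sumE j)// (sumE j').
rewrite -{}jj in yj.
have [_ /(_ x y xj yj)[a [b [/andP[a1 ab] [b1' dab]]]]] := ih j.
have [_ _ /(_ j)[bm _ _ _]] := Hcons.
exists a, b; split.
  rewrite ab andbT (leq_trans _ a1)//= leq_mul2r leq_add2l leq0n orbT//.
split; first by rewrite (leq_trans b1')//= leq_mul2r -addnS leq_add2l bm orbT.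
by move: dab; rewrite !dev_addb.
Qed.

End Heights.
End Gadgets.

Definition single_code : code single_edge :=
  @Code single_edge (fun x p => (x : bool) && (p == 0%N)) (fun=> 0%N) (fun=> false).

Lemma single_code_consistent : consistent single_code.
Proof. by move=> []; split => //= p /negPf ->. Qed.

Lemma single_edge_covered : covered single_edge.
Proof. by move=> []; exists tt; [right|left]. Qed.

Section GadgetGraphs.
Variables (k m : nat) (H : gadget k) (P : bool + 'I_k -> nat -> bool)
  (blk : 'I_(size H) -> nat) (rv : 'I_(size H) -> bool).
Hypothesis m0 : (0 < m)%N.
Hypothesis Hcons : gadget_consistent m P blk rv.
Hypothesis Hcov : gadget_covered H.

Lemma edge_adjacent_edge (G : edge_graph) (e : edge G) :
  edge_adjacent (edge_ends e).1 (edge_ends e).2.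
Proof. by apply/existsP; exists e; rewrite -surjective_pairing eqxx. Qed.

Lemma gadget_graph_coding N : gadget_metric m P blk rv ->
  coding (G := of_edge_graph (iter_replace H N single_edge)) (m ^ N)
    (pot (iter_code m P blk rv N single_code)).
Proof.
move=> Hmet; have cc := single_code_consistent; split=> [l x y /existsP[e]|x y].
  have [_ _ h] := @iter_code_consistent _ _ _ m0 _ _ _ Hcons N _ _ cc e.
  case/orP => /eqP ee; rewrite ee /= in h.
    exact: hamming_le1 h.
  by apply: (@hamming_le1 _ _ _ _ (fun j jne => esym (h j jne))).
have [] := @inside_heights _ _ _ m0 _ _ _ Hcons Hcov Hmet N single_edge single_code
  (of_edge_graph (iter_replace H N single_edge)) id tt cc _.
  by move=> e; apply: graph_dist_adj; exact: edge_adjacent_edge.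
move=> _ /(_ x y) dxy.
have [[] xe] := inside_covered Hcov single_edge_covered x.
have [[] ye] := inside_covered Hcov single_edge_covered y.
have [a [b [/andP[_ ab] [b1 d]]]] := dxy xe ye.
by exists a, b; split=> //; rewrite ab; move: b1; rewrite mul1n.
Qed.

Variables (R : realType) (X : normedModType R) (K : set X) (th : R).
Hypothesis th0 : 0 < th.

(** The inductive step for bushes, with [h] the distance between the ends of a grown gadget edge;
    slots with different patterns are separated because their codes differ on a whole block of
    length [h]. *)
Definition gadget_bush : Prop := forall N (f : bool + 'I_k -> X) (h : R), 0 < h ->
  (forall j : 'I_(size H), bush K th N (h^-1 *: (f (gadget_dst j) - f (gadget_src j)))) ->
  (forall w w' i, (i < m)%N -> P w i != P w' i -> th * h <= `|f w - f w'|) ->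
  bush K th N.+1 ((m%:R * h)^-1 *: (f (inl true) - f (inl false))).

Lemma iter_replace_bush N G (c : code G) (f : node (iter_replace H N G) -> X)
    (e : edge G) : gadget_bush -> consistent c ->
  (forall e' : edge (iter_replace H N G), K (f (edge_ends e').2 - f (edge_ends e').1)) ->
  (forall a b x y, th * (dev a b (pot (iter_code m P blk rv N c) x)
     (pot (iter_code m P blk rv N c) y))%:R <= `|f x - f y|) ->
  bush K th N ((m ^ N)%:R^-1 *: (f (old_node H N (edge_ends e).2) -
    f (old_node H N (edge_ends e).1))).
Proof.
move=> Hb; elim: N G c f e => [|N ih] G c f e cc edges sep.
  by rewrite expn0 invr1 scale1r; exact: edges.
have cc' := replace_code_consistent m0 Hcons cc.
rewrite expnS natrM.
have h0 : (0 < m ^ N)%N by rewrite expn_gt0 m0.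
apply: (Hb N (fun w => f (@old_node _ H N (replace_edges H G) (gadget_node e w)))).
- by rewrite ltr0n.
- by move=> j; exact: (ih _ _ _ ((e, j) : edge (replace_edges H G)) cc' edges sep).
move=> w w' i im wi; set x := old_node _ _ _; set y := old_node _ _ _.
set q := (m * lab c e + i)%N.
apply: le_trans (sep (q * m ^ N)%N (q.+1 * m ^ N)%N x y).
rewrite ler_pM2l// ler_nat.
have cE v : cnt (q * m ^ N) (q.+1 * m ^ N)
      (pot (iter_code m P blk rv N.+1 c) (@old_node _ H N (replace_edges H G) (gadget_node e v)))
    = ((sgn c e (+) P v i) * m ^ N)%N.
  transitivity ((sgn c e (+) P v i) * (q.+1 * m ^ N - q * m ^ N))%N; last first.
    by rewrite -mulnBl subSn// subnn mul1n.
  rewrite -cnt_const; apply: eq_cnt => p /andP[p1 p2] /=.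
  have pE : (p %/ m ^ N)%N = q.
    by apply/eqP; rewrite eqn_leq leq_divRL// p1 -ltnS ltn_divLR// p2.
  rewrite iter_code_old (pot_gadget_node Hcons)// /slot_code pE.
  by rewrite (divn_block m0)// modn_block// eqxx.
rewrite /dev !cE; move: wi; case: (P w i); case: (P w' i) => // _;
  case: (sgn c e); rewrite /= ?mul0n ?mul1n ?subn0 ?sub0n ?addn0 ?add0n//.
Qed.

Lemma gadget_graph_bush N
    (f : vertex (of_edge_graph (iter_replace H N single_edge)) -> X) :
  gadget_bush ->
  (forall x y, graph_adj x y -> x != y -> K (f x - f y)) ->
  (forall a b x y, th * (dev a b (pot (iter_code m P blk rv N single_code) x)
     (pot (iter_code m P blk rv N single_code) y))%:R <= `|f x - f y|) ->
  exists x, bush K th N x.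
Proof.
move=> Hb fK sep; have cc := single_code_consistent.
eexists; apply: (@iter_replace_bush N single_edge single_code f tt Hb cc _ sep) => e.
apply: fK.
  by rewrite /= edge_adjacent_sym; exact: edge_adjacent_edge.
have [h1 h2 _] := @iter_code_consistent _ _ _ m0 _ _ _ Hcons N _ _ cc e.
by apply/eqP => ee; move: h2; rewrite ee h1; case: (sgn _ _).
Qed.

End GadgetGraphs.

(** * Diamond and Laakso gadgets *)

Section GadgetTables.
Variable k : nat.

Definition slot_index (w : bool + 'I_k) : nat :=
  match w with inl b => b | inr i => i.+2 end.

Definition slot_blocks (tab : seq (seq bool)) (w : bool + 'I_k) (i : nat) : bool :=
  match w with inl b => b | inr c => nth false (nth [::] tab c) i end.

Definition slot_dist (tab : seq (seq nat)) (w w' : bool + 'I_k) : nat :=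
  nth 0%N (nth [::] tab (slot_index w)) (slot_index w').

(** Reduces the gadget condition to linear arithmetic over a distance table [D]: an end of the
    gadget is reached through both ends of an edge, and two points are joined by four routes. *)
Lemma gadget_metric_of_dist (H : gadget k) (m : nat) P blk rv (D : bool + 'I_k -> bool + 'I_k -> nat) :
  (forall (T : Type) (d : T -> T -> nat) (h : nat) (z : bool + 'I_k -> T),
    (forall x, d x x = 0%N) -> (forall x y, d x y = d y x) ->
    (forall x y t, d x t <= d x y + d y t)%N ->
    (forall j : 'I_(size H), d (z (gadget_src j)) (z (gadget_dst j)) <= h)%N ->
    forall p q, (d (z p) (z q) <= D p q * h)%N) ->
  (forall (h : nat) (j : 'I_(size H)) A r1 r2, (A <= h)%N ->
    (r1 <= D (inl false) (gadget_src j) * h + A)%N ->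
    (r1 <= D (inl false) (gadget_dst j) * h + (h - A))%N ->
    (r2 <= D (inl true) (gadget_src j) * h + A)%N ->
    (r2 <= D (inl true) (gadget_dst j) * h + (h - A))%N ->
    (r1 <= \sum_(0 <= i < m) block_height P blk rv h j A i /\
     r2 <= m * h - \sum_(0 <= i < m) block_height P blk rv h j A i)%N) ->
  (forall (h : nat) (j j' : 'I_(size H)) A B r, j != j' -> (A <= h)%N -> (B <= h)%N ->
    (r <= A + D (gadget_src j) (gadget_src j') * h + B)%N ->
    (r <= A + D (gadget_src j) (gadget_dst j') * h + (h - B))%N ->
    (r <= (h - A) + D (gadget_dst j) (gadget_src j') * h + B)%N ->
    (r <= (h - A) + D (gadget_dst j) (gadget_dst j') * h + (h - B))%N ->
    exists i1 i2, (i1 <= i2 <= m)%N /\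
      let s := (\sum_(i1 <= i < i2) block_height P blk rv h j A i)%N in
      let t := (\sum_(i1 <= i < i2) block_height P blk rv h j' B i)%N in
      (r <= 2 * ((s - t) + (t - s)))%N) ->
  gadget_metric m P blk rv.
Proof.
move=> HD Hends Hpairs T d h z d0 ds dt e j x A Ah xs xd.
have F := HD T d h z d0 ds dt e.
have f1 p : (d (z p) x <= D p (gadget_src j) * h + A)%N.
  by apply: leq_trans (dt _ (z (gadget_src j)) _) _; rewrite leq_add.
have f2 p : (d (z p) x <= D p (gadget_dst j) * h + (h - A))%N.
  by apply: leq_trans (dt _ (z (gadget_dst j)) _) _; rewrite leq_add// ds.
have [h1 h2] := Hends h j A _ _ Ah (f1 _) (f2 _) (f1 _) (f2 _).
split=> // [|j' y B jj Bh ys yd]; first by rewrite ds.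
have route p q a b : (d x (z p) <= a)%N -> (d (z q) y <= b)%N ->
    (d x y <= a + D p q * h + b)%N.
  move=> xa yb; apply: leq_trans (dt _ (z q) _) _; apply: leq_add yb.
  by apply: leq_trans (dt _ (z p) _) _; apply: leq_add xa (F p q).
rewrite ds in xs; rewrite ds in yd.
by apply: (Hpairs h j j' A B (d x y)) => //; exact: route.
Qed.

End GadgetTables.

(** The brackets measure how far [x] and [y] are from bisecting [u] and [v]; two points that both
    nearly bisect are close together. *)
Lemma midpoint_difference (R : realType) (X : lmodType R) (u v x y : X) :
  x - y = 2^-1 *: ((x - u - (v - x)) - (y - u - (v - y))).
Proof.
have opp (z : X) : z - u - (v - z) = z *+ 2 - (u + v).
  by rewrite opprB addrCA addrA mulr2n opprD !addrA addrAC.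
rewrite !opp opprB addrA subrK.
by rewrite -mulrnBl -[(x - y) *+ 2]scaler_nat scalerA mulVf ?scale1r.
Qed.

Section Diamond.

Let src0 : (bool + 'I_2) * (bool + 'I_2) := (inl false, inl false).

(** The vertices u, a, b, v have the patterns 00, 10, 01, 11. *)
Definition diamond_blocks : bool + 'I_2 -> nat -> bool :=
  slot_blocks [:: [:: true; false]; [:: false; true]].
Definition diamond_blk (j : 'I_(size diamond_gadget)) : nat := nth 0%N [:: 0; 1; 0; 1] j.
Definition diamond_rv (j : 'I_(size diamond_gadget)) : bool :=
  nth false [:: false; false; true; true] j.
Definition diamond_dist : bool + 'I_2 -> bool + 'I_2 -> nat :=
  slot_dist [:: [:: 0; 2; 1; 1]; [:: 2; 0; 1; 1]; [:: 1; 1; 0; 2]; [:: 1; 1; 2; 0]]%N.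

Lemma diamond_consistent : gadget_consistent 2 diamond_blocks diamond_blk diamond_rv.
Proof.
split=> // -[[|[|[|[|//]]]] jP]; split=> //;
  rewrite /gadget_src /gadget_dst !(tnth_nth src0) /=; by case=> [|[|]].
Qed.

Lemma diamond_covered : gadget_covered diamond_gadget.
Proof.
have j0 : (0 < size diamond_gadget)%N by []. 
have j2 : (2 < size diamond_gadget)%N by [].
move=> [[]|[[|[|//]] i2]].
- by exists (Ordinal j2); left; rewrite /gadget_src (tnth_nth src0).
- by exists (Ordinal j0); left; rewrite /gadget_src (tnth_nth src0).
- exists (Ordinal j0); right; rewrite /gadget_dst (tnth_nth src0) /=.
  by congr inr; exact: val_inj.
- exists (Ordinal j2); right; rewrite /gadget_dst (tnth_nth src0) /=.
  by congr inr; exact: val_inj.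
Qed.

Lemma diamond_metric : gadget_metric 2 diamond_blocks diamond_blk diamond_rv.
Proof.
apply: (gadget_metric_of_dist (D := diamond_dist)).
- move=> T d h z d0 ds dt e.
  have := e (@Ordinal 4 0 isT); have := e (@Ordinal 4 1 isT).
  have := e (@Ordinal 4 2 isT); have := e (@Ordinal 4 3 isT).
  rewrite /gadget_src /gadget_dst !(tnth_nth src0) /=.
  set a := inr (@Ordinal 2 0 _); set b := inr (@Ordinal 2 1 _) => e3 e2 e1 e0.
  have uv := dt (z (inl false)) (z a) (z (inl true)).
  have ab := dt (z a) (z (inl true)) (z b).
  have slotP w : [\/ w = inl false, w = inl true, w = a | w = b].
    case: w => [[]|[[|[|//]] i2]]; [exact: Or42|exact: Or41|apply: Or43|apply: Or44];
    by congr inr; exact: val_inj.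
  move=> p q; rewrite /diamond_dist /slot_dist.
  case: (slotP p) => ->; case: (slotP q) => -> /=; rewrite ?d0//; 
    do ?[lia | rewrite ds; lia].
- move=> h [[|[|[|[|//]]]] jP] A r1 r2;
  rewrite /block_height /gadget_src /gadget_dst !(tnth_nth src0)
    /index_iota /= !big_cons !big_nil /diamond_blk /diamond_rv
    /diamond_dist /slot_dist /=; lia.
move=> h j j' A B r jj Ah Bh r1 r2 r3 r4.
pose s i1 i2 := (\sum_(i1 <= i < i2) block_height diamond_blocks diamond_blk diamond_rv h j A i)%N.
pose t i1 i2 := (\sum_(i1 <= i < i2) block_height diamond_blocks diamond_blk diamond_rv h j' B i)%N.
suff : [|| r <= 2 * ((s 0 1 - t 0 1) + (t 0 1 - s 0 1)),
  r <= 2 * ((s 1 2 - t 1 2) + (t 1 2 - s 1 2))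
  | r <= 2 * ((s 0 2 - t 0 2) + (t 0 2 - s 0 2))]%N.
  by case/or3P => ?; [exists 0%N, 1%N|exists 1%N, 2%N|exists 0%N, 2%N].
rewrite {}/s {}/t; move: jj r1 r2 r3 r4.
case: j => [[|[|[|[|//]]]] jP]; case: j' => [[|[|[|[|//]]]] jP'] //= _;
  rewrite /block_height /gadget_src /gadget_dst !(tnth_nth src0)
    /index_iota /= !big_cons !big_nil /diamond_blk /diamond_rv
    /diamond_dist /slot_dist /=; lia.
Qed.

(** As [a] and [b] are far apart, one of them is far from bisecting u and v, and its two
    half-increments are separated. Symmetry of [K] corrects the orientation of the edges from v
    through b to u. *)
Lemma diamond_bush (R : realType) (X : normedModType R) (K : set X) (th : R) :
  (forall y, K y -> K (- y)) ->
  gadget_bush 2 diamond_gadget diamond_blocks K th.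
Proof.
move=> KN N f h h0 fj sep.
pose a : bool + 'I_2 := inr (@Ordinal 2 0 isT).
pose b : bool + 'I_2 := inr (@Ordinal 2 1 isT).
have := fj (@Ordinal 4 0 isT); have := fj (@Ordinal 4 1 isT).
have := bushN KN (fj (@Ordinal 4 2 isT)); have := bushN KN (fj (@Ordinal 4 3 isT)).
rewrite /gadget_src /gadget_dst !(tnth_nth src0) /= -/a -/b -!scalerN !opprB.
set u := f (inl false); set v := f (inl true) => q2 p2 p1 q1.
have ab : th * h <= `|f a - f b| by apply: (sep a b 0%N).
have half (c : X) : th * h <= `|c - u - (v - c)| ->
    bush K th N (h^-1 *: (c - u)) -> bush K th N (h^-1 *: (v - c)) ->
    bush K th N.+1 ((2 * h)^-1 *: (v - u)).
  move=> cth bp bq; rewrite invfM -scalerA (_ : v - u = (c - u) + (v - c)).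
    rewrite scalerDr; apply: bush_midpoint => //.
    by rewrite -scalerBr normrZ gtr0_norm ?invr_gt0// mulrC ler_pdivlMr.
  by rewrite [RHS]addrC addrA subrK.
have [c|c] := leP (th * h) `|f a - u - (v - f a)|; first exact: half c q1 p1.
apply: (half (f b)) => //; apply: contraTle ab => c'; rewrite -ltNge.
rewrite (midpoint_difference u v) normrZ gtr0_norm ?invr_gt0// mulrC ltr_pdivrMr//.
by apply: le_lt_trans (ler_normB _ _) _; lra.
Qed.

End Diamond.

Section Laakso.

Let src0 : (bool + 'I_4) * (bool + 'I_4) := (inl false, inl false).

(** The vertices a, b, c, d have the patterns 1000, 1100, 1010, 1110: b and c differ in the two
    middle blocks. *)
Definition laakso_blocks : bool + 'I_4 -> nat -> bool :=
  slot_blocks [:: [:: true; false; false; false]; [:: true; true; false; false];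
    [:: true; false; true; false]; [:: true; true; true; false]].
Definition laakso_blk (j : 'I_(size laakso_gadget)) : nat :=
  nth 0%N [:: 0; 1; 2; 2; 1; 3] j.
Definition laakso_rv (j : 'I_(size laakso_gadget)) : bool := false.
Definition laakso_dist : bool + 'I_4 -> bool + 'I_4 -> nat :=
  slot_dist [:: [:: 0; 4; 1; 2; 2; 3]; [:: 4; 0; 3; 2; 2; 1]; [:: 1; 3; 0; 1; 1; 2];
    [:: 2; 2; 1; 0; 2; 1]; [:: 2; 2; 1; 2; 0; 1]; [:: 3; 1; 2; 1; 1; 0]]%N.

Lemma laakso_consistent : gadget_consistent 4 laakso_blocks laakso_blk laakso_rv.
Proof.
split=> // -[[|[|[|[|[|[|//]]]]]] jP]; split=> //;
  rewrite /gadget_src /gadget_dst !(tnth_nth src0) /=; by case=> [|[|[|[|]]]].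
Qed.

Lemma laakso_covered : gadget_covered laakso_gadget.
Proof.
have j0 : (0 < size laakso_gadget)%N by [].
have j1 : (1 < size laakso_gadget)%N by [].
have j4 : (4 < size laakso_gadget)%N by [].
have j5 : (5 < size laakso_gadget)%N by [].
move=> [[]|[[|[|[|[|//]]]] i4]].
- by exists (Ordinal j5); right; rewrite /gadget_dst (tnth_nth src0).
- by exists (Ordinal j0); left; rewrite /gadget_src (tnth_nth src0).
- exists (Ordinal j0); right; rewrite /gadget_dst (tnth_nth src0) /=.
  by congr inr; exact: val_inj.
- exists (Ordinal j1); right; rewrite /gadget_dst (tnth_nth src0) /=.
  by congr inr; exact: val_inj.
- exists (Ordinal j4); left; rewrite /gadget_src (tnth_nth src0) /=.
  by congr inr; exact: val_inj.
- exists (Ordinal j5); left; rewrite /gadget_src (tnth_nth src0) /=.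
  by congr inr; exact: val_inj.
Qed.

Lemma laakso_metric : gadget_metric 4 laakso_blocks laakso_blk laakso_rv.
Proof.
apply: (gadget_metric_of_dist (D := laakso_dist)).
- move=> T d h z d0 ds dt e.
  have := e (@Ordinal 6 0 isT); have := e (@Ordinal 6 1 isT).
  have := e (@Ordinal 6 2 isT); have := e (@Ordinal 6 3 isT).
  have := e (@Ordinal 6 4 isT); have := e (@Ordinal 6 5 isT).
  rewrite /gadget_src /gadget_dst !(tnth_nth src0) /=.
  set a := inr (@Ordinal 4 0 _); set b := inr (@Ordinal 4 1 _).
  set c := inr (@Ordinal 4 2 _); set D := inr (@Ordinal 4 3 _) => e5 e4 e3 e2 e1 e0.
  have ub := dt (z (inl false)) (z a) (z b).
  have uc := dt (z (inl false)) (z a) (z c).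
  have bc := dt (z b) (z a) (z c).
  have aD := dt (z a) (z b) (z D).
  have uD := dt (z (inl false)) (z a) (z D).
  have bv := dt (z b) (z D) (z (inl true)).
  have cv := dt (z c) (z D) (z (inl true)).
  have av := dt (z a) (z D) (z (inl true)).
  have uv := dt (z (inl false)) (z a) (z (inl true)).
  rewrite (ds (z b) (z a)) in bc.
  have slotP w : w = inl false \/ w = inl true \/ w = a \/ w = b \/ w = c \/ w = D.
    case: w => [[]|[[|[|[|[|//]]]] i4]]; first by right; left.
    + by left.
    + by do 2!right; left; congr inr; exact: val_inj.
    + by do 3!right; left; congr inr; exact: val_inj.
    + by do 4!right; left; congr inr; exact: val_inj.
    + by do 5!right; congr inr; exact: val_inj.
  move=> p q; rewrite /laakso_dist /slot_dist.
  case: (slotP p) => [|[|[|[|[|]]]]] ->; case: (slotP q) => [|[|[|[|[|]]]]] -> /=;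
    rewrite ?d0//; do ?[lia | rewrite ds; lia].
- move=> h [[|[|[|[|[|[|//]]]]]] jP] A r1 r2;
  rewrite /block_height /gadget_src /gadget_dst !(tnth_nth src0)
    /index_iota /= !big_cons !big_nil /laakso_blk /laakso_rv
    /laakso_dist /slot_dist /=; lia.
move=> h j j' A B r jj Ah Bh r1 r2 r3 r4.
pose s i1 i2 := (\sum_(i1 <= i < i2) block_height laakso_blocks laakso_blk laakso_rv h j A i)%N.
pose t i1 i2 := (\sum_(i1 <= i < i2) block_height laakso_blocks laakso_blk laakso_rv h j' B i)%N.
suff : [|| r <= 2 * ((s 1 2 - t 1 2) + (t 1 2 - s 1 2)),
  r <= 2 * ((s 2 3 - t 2 3) + (t 2 3 - s 2 3))
  | r <= 2 * ((s 0 4 - t 0 4) + (t 0 4 - s 0 4))]%N.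
  by case/or3P => ?; [exists 1%N, 2%N|exists 2%N, 3%N|exists 0%N, 4%N].
rewrite {}/s {}/t; move: jj r1 r2 r3 r4.
case: j => [[|[|[|[|[|[|//]]]]]] jP]; case: j' => [[|[|[|[|[|[|//]]]]]] jP'] //= _;
  rewrite /block_height /gadget_src /gadget_dst !(tnth_nth src0)
    /index_iota /= !big_cons !big_nil /laakso_blk /laakso_rv
    /laakso_dist /slot_dist /=; lia.
Qed.

(** One of [b] and [c] is far from bisecting a and d; the increments along the path from u to v
    through it are the four children, the middle two being separated. *)
Lemma laakso_bush (R : realType) (X : normedModType R) (K : set X) (th : R) :
  gadget_bush 4 laakso_gadget laakso_blocks K th.
Proof.
move=> N f h h0 fj sep.
pose a : bool + 'I_4 := inr (@Ordinal 4 0 isT).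
pose b : bool + 'I_4 := inr (@Ordinal 4 1 isT).
pose c : bool + 'I_4 := inr (@Ordinal 4 2 isT).
pose D : bool + 'I_4 := inr (@Ordinal 4 3 isT).
have := fj (@Ordinal 6 0 isT); have := fj (@Ordinal 6 1 isT).
have := fj (@Ordinal 6 2 isT); have := fj (@Ordinal 6 3 isT).
have := fj (@Ordinal 6 4 isT); have := fj (@Ordinal 6 5 isT).
rewrite /gadget_src /gadget_dst !(tnth_nth src0) /= -/a -/b -/c -/D.
set u := f (inl false); set v := f (inl true) => r cD bD ac ab p.
have bc : th * h <= `|f b - f c| by apply: (sep b c 1%N).
have half (x : X) : th * h <= `|x - f a - (f D - x)| ->
    bush K th N (h^-1 *: (x - f a)) -> bush K th N (h^-1 *: (f D - x)) ->
    exists p q1 q2 r, [/\ [/\ bush K th N p, bush K th N q1, bush K th N q2 & bush K th N r],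
      (4 * h)^-1 *: (v - u) = 4^-1 *: (p + q1 + q2 + r) & th <= `|q1 - q2|].
  move=> xth b1 b2; exists (h^-1 *: (f a - u)), (h^-1 *: (x - f a)),
    (h^-1 *: (f D - x)), (h^-1 *: (v - f D)); split=> //.
    rewrite -!scalerDr scalerA -invfM; congr (_ *: _).
    rewrite [RHS]addrC [f a - u + _ + _]addrC [f a - u + _]addrC.
    by rewrite !addrA !subrK.
  by rewrite -scalerBr normrZ gtr0_norm ?invr_gt0// mulrC ler_pdivlMr.
have [x|x] := leP (th * h) `|f b - f a - (f D - f b)|; first exact: half x ab bD.
apply: (half (f c)) => //; apply: contraTle bc => x'; rewrite -ltNge.
by rewrite (midpoint_difference (f a) (f D)) normrZ gtr0_norm ?invr_gt0//
  mulrC ltr_pdivrMr//; apply: le_lt_trans (ler_normB _ _) _; lra.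
Qed.

End Laakso.

(** * Binary trees *)

Section TreeCode.

(** The number of edges of the binary tree of height [h], that is 2^(h+1) - 2; each edge owns one
    bit. *)
Fixpoint tree_size (h : nat) : nat := if h is h'.+1 then (tree_size h').+1.*2 else 0%N.

Definition branch_offset (h : nat) (b : bool) : nat := if b then (tree_size h).+1 else 0%N.

(** Marks the edges on the path from the root to [s], listed in preorder: the edge to a child stands
    at [branch_offset], just before the edges below that child. *)
Fixpoint tree_code (h : nat) (s : seq bool) (j : nat) : bool :=
  match h, s with
  | h'.+1, b :: s' => let o := branch_offset h' b in
      (j == o) || (o < j)%N && tree_code h' s' (j - o.+1)
  | _, _ => false
  end.

Lemma tree_code_support h s j : tree_code h s j -> (j < tree_size h)%N.
Proof.
elim: h s j => [|h ih] [|b s] j //=; rewrite /branch_offset => /orP[/eqP ->|].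
  by rewrite -addnn; case: b; lia.
by move=> /andP[oj /ih]; rewrite -addnn; case: b oj; lia.
Qed.

Lemma tree_code_nil h j : tree_code h [::] j = false.
Proof. by case: h. Qed.

Lemma cnt_shift a k l b : cnt (a + k) (a + l) b = cnt k l (fun j => b (a + j)%N).
Proof.
rewrite /cnt addnC big_addn addnC addnK.
by apply: eq_bigr => j _; rewrite addnC.
Qed.

Lemma tree_code_cons_shift h b s j :
  tree_code h.+1 (b :: s) ((branch_offset h b).+1 + j) = tree_code h s j.
Proof. by rewrite /= addSn gtn_eqF ?ltnS ?leq_addr//= -addSn addKn. Qed.

Lemma cnt_tree_code_shift h b k l s :
  cnt ((branch_offset h b).+1 + k) ((branch_offset h b).+1 + l)
    (tree_code h.+1 (b :: s)) = cnt k l (tree_code h s).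
Proof. by rewrite cnt_shift; apply: eq_cnt => j _; rewrite tree_code_cons_shift. Qed.

Lemma cnt_false k l (b : nat -> bool) :
  (forall j, (k <= j < l)%N -> b j = false) -> cnt k l b = 0%N.
Proof. by move=> bF; rewrite (eq_cnt (b' := fun=> false))// cnt_const. Qed.

Lemma cnt_tree_code_block h b s :
  cnt (branch_offset h b) (branch_offset h b + (tree_size h).+1) (tree_code h.+1 (b :: s))
  = (cnt 0 (tree_size h) (tree_code h s)).+1.
Proof.
set o := branch_offset h b.
rewrite (@cnt_cat _ o.+1); last by rewrite leqnSn -addn1 leq_add2l.
rewrite {1}/cnt big_nat1 /= eqxx /= add1n; congr _.+1.
by have := cnt_tree_code_shift h b 0 (tree_size h) s; rewrite addn0 addSnnS.
Qed.

Lemma cnt_tree_code_other h b s :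
  cnt (branch_offset h (~~ b)) (branch_offset h (~~ b) + (tree_size h).+1)
    (tree_code h.+1 (b :: s)) = 0%N.
Proof.
apply: cnt_false => j; rewrite /= /branch_offset; case: b => /= jo;
  by apply/negbTE/negP => /orP[/eqP|/andP[oj /tree_code_support]]; lia.
Qed.

Lemma cnt_tree_code h s : (size s <= h)%N ->
  cnt 0 (tree_size h) (tree_code h s) = size s.
Proof.
elim: h s => [|h ih] [|b s] //= sh; try by rewrite cnt_false.
rewrite -(ih s sh) -(cnt_tree_code_block h b).
have c1 := cnt_tree_code_other h b s; have c2 := cnt_tree_code_block h b s.
rewrite (@cnt_cat _ (tree_size h).+1); last by rewrite -addnn; lia.
rewrite -addnn; case: b c1 c2; rewrite /branch_offset /= !add0n => -> _.
  by rewrite add0n.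
by rewrite addn0.
Qed.

Lemma dev_fork h b s t : (size s <= h)%N ->
  dev (branch_offset h b) (branch_offset h b + (tree_size h).+1)
    (tree_code h.+1 (b :: s)) (tree_code h.+1 (~~ b :: t)) = (size s).+1.
Proof.
move=> sh; rewrite /dev cnt_tree_code_block cnt_tree_code//.
by have := cnt_tree_code_other h (~~ b) t; rewrite negbK => ->; rewrite subn0 addn0.
Qed.

Lemma devC k l b b' : dev k l b b' = dev k l b' b.
Proof. by rewrite /dev addnC. Qed.

Lemma branch_offset_le h b : (branch_offset h b + (tree_size h).+1 <= tree_size h.+1)%N.
Proof. by rewrite /branch_offset /= -addnn; case: b; lia. Qed.

(** Below the last common ancestor, the interval of the longer branch contains none of the other
    branch's bits there, so its deviation is the greater of the two lengths, at least half of their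
    sum. *)
Lemma tree_code_dev h s t : (size s <= h)%N -> (size t <= h)%N ->
  exists p s' t' k l, [/\ s = p ++ s', t = p ++ t', (k <= l <= tree_size h)%N
    & (size s' + size t' <= 2 * dev k l (tree_code h s) (tree_code h t))%N].
Proof.
have nil_dev h' u : (size u <= h')%N ->
    (size u <= dev 0 (tree_size h') (tree_code h' [::]) (tree_code h' u))%N.
  by move=> uh; rewrite /dev !cnt_tree_code//= sub0n subn0.
elim: h s t => [|h ih] [|b s] [|c t] //= sh th.
- by exists [::], [::], [::], 0%N, 0%N.
- by exists [::], [::], [::], 0%N, 0%N.
- exists [::], [::], (c :: t), 0%N, (tree_size h.+1); split; rewrite ?leqnn//.
  by have := nil_dev h.+1 (c :: t) th; rewrite /=; lia.
- exists [::], (b :: s), [::], 0%N, (tree_size h.+1); split; rewrite ?leqnn//.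
  by have := nil_dev h.+1 (b :: s) sh; rewrite devC /=; lia.
have [bc|bc] := eqVneq b c.
  rewrite -{}bc; have [p [s' [t' [k [l [-> -> /andP[kl lh] d]]]]]] := ih s t sh th.
  exists (b :: p), s', t', ((branch_offset h b).+1 + k)%N, ((branch_offset h b).+1 + l)%N.
  split=> //; last by rewrite /dev !cnt_tree_code_shift.
  rewrite leq_add2l kl/= (leq_trans _ (branch_offset_le h b))//.
  by rewrite addSnnS leq_add2l ltnS.
have {bc}-> : c = ~~ b by case: b c bc => [] [].
have [st|st] := leqP (size t) (size s).
  exists [::], (b :: s), (~~ b :: t), (branch_offset h b),
    (branch_offset h b + (tree_size h).+1)%N.
  by split; rewrite ?leq_addr ?branch_offset_le//= dev_fork// mul2n -addnn leq_add.
exists [::], (b :: s), (~~ b :: t), (branch_offset h (~~ b)),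
  (branch_offset h (~~ b) + (tree_size h).+1)%N.
split; rewrite ?leq_addr ?branch_offset_le// devC.
have := @dev_fork h (~~ b) t s th; rewrite negbK => ->.
by rewrite mul2n -addnn leq_add//; exact: ltnW.
Qed.

Lemma tree_code_fork h p s t : (size (p ++ false :: s) <= h)%N -> exists k l,
  ((size s).+1 <= dev k l (tree_code h (p ++ false :: s)) (tree_code h (p ++ true :: t)))%N.
Proof.
elim: p h => [|b p ih] [|h] //=; rewrite ltnS => sh.
  by exists (branch_offset h false), (branch_offset h false + (tree_size h).+1)%N;
    rewrite (dev_fork false).
have [k [l d]] := ih h sh.
exists ((branch_offset h b).+1 + k)%N, ((branch_offset h b).+1 + l)%N.
by rewrite /dev !cnt_tree_code_shift.
Qed.

Lemma tree_code_rcons h s b : exists q, forall j, j != q ->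
  tree_code h s j = tree_code h (rcons s b) j.
Proof.
elim: h s => [|h ih] [|c s]; try by exists 0%N.
  exists (branch_offset h b) => j /negPf jo.
  by rewrite /= jo tree_code_nil andbF.
have [q qP] := ih s; exists ((branch_offset h c).+1 + q)%N => j jq /=.
case: eqP => //= _; case: ltnP => //= oj; apply: qP.
by apply: contra jq => /eqP <-; rewrite subnKC.
Qed.

End TreeCode.

Section BinaryTrees.
Variable N : nat.
Local Notation T := (vertex (binary_tree N)).

Lemma tree_dist_prefix p s (x y : T) : val x = p -> val y = p ++ s ->
  (graph_dist x y <= size s)%N.
Proof.
move=> xp; elim/last_ind: s y => [|s b ih] y ys.
  rewrite cats0 -xp in ys; rewrite (_ : y = x) ?graph_dist_refl//; exact: val_inj.
have sN : (size (p ++ s) <= N)%N.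
  by have := valP y; rewrite ys -rcons_cat size_rcons; exact: ltnW.
rewrite size_rcons; apply: leq_trans (graph_dist_triangle (Bseq sN : T) x y) _.
rewrite -addn1 leq_add ?ih//; apply: graph_dist_adj; apply/existsP; exists b.
by apply/orP; left; apply/eqP; rewrite /= rcons_cat; exact: ys.
Qed.

Lemma binary_tree_coding :
  coding (G := binary_tree N) (tree_size N) (fun x => tree_code N (val x)).
Proof.
split=> [l x y /existsP[b /orP[] /eqP e]|x y].
- by have [q qP] := tree_code_rcons N (val x) b; rewrite (e : val y = _); apply: hamming_le1 qP.
- have [q qP] := tree_code_rcons N (val y) b; rewrite (e : val x = _).
  by apply: (@hamming_le1 _ _ _ q) => j /qP ->.
have [p [s [t [k [l [xs yt kl d]]]]]] := tree_code_dev (valP x) (valP y).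
exists k, l; split=> //; apply: leq_trans d.
have pN : (size p <= N)%N.
  by apply: leq_trans (valP x); rewrite xs size_cat leq_addr.
apply: leq_trans (graph_dist_triangle (Bseq pN : T) x y) _.
rewrite graph_dist_sym leq_add//; exact: tree_dist_prefix.
Qed.

Variables (R : realType) (X : normedModType R) (K : set X) (th : R) (f : T -> X).
Hypothesis th0 : 0 < th.
Hypothesis fK : forall x y : T, graph_adj x y -> x != y -> K (f x - f y).
Hypothesis fsep : forall k l (x y : T),
  th * (dev k l (tree_code N (val x)) (tree_code N (val y)))%:R <= `|f x - f y|.

(** By induction there is a good descent of length 2^k from [p] in a prescribed first direction.
    From its end [P] two descents start in different directions; their increments are [th] apart, so
    one is th / 2 away from the increment up to [P] and is appended to it. *)
Lemma binary_tree_bush k : (2 ^ k <= N)%N -> exists x, bush K (th / 2) k x.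
Proof.
(* Sequences longer than [N] are sent to the root; the length bounds below exclude this case. *)
move=> kN; pose v (s : seq bool) : T := insubd ([bseq] : N.-bseq bool) s.
have vE s : (size s <= N)%N -> val (v s) = s by move=> sN; rewrite val_insubd sN.
pose g s := f (v s).
suff /(_ [::] false) : forall p b, (size p + 2 ^ k <= N)%N -> exists r,
    (size r).+1 = (2 ^ k)%N /\
    bush K (th / 2) k ((2 ^+ k)^-1 *: (g (p ++ b :: r) - g p)).
  by move=> /(_ kN)[r [_ br]]; eexists; exact: br.
elim: k {kN} => [|k ih] p b pN.
  exists [::]; rewrite expr0 invr1 scale1r; split=> //; rewrite addn1 in pN.
  have sN : (size (p ++ [:: b]) <= N)%N by rewrite size_cat addn1.
  apply: fK.
    by apply/existsP; exists b; rewrite !vE// ?(ltnW pN)// cats1 eqxx orbT.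
  apply/eqP => /(congr1 (size \o val)); rewrite /= !vE// ?(ltnW pN)// size_cat.
  by rewrite addn1; lia.
rewrite expnS mul2n -addnn addnA in pN.
have [r [rk br]] := ih p b (leq_trans (leq_addr _ _) pN).
have prN : (size (p ++ b :: r) + 2 ^ k <= N)%N by rewrite size_cat /= rk.
have [s [sk bs]] := ih _ false prN; have [t [tk bt]] := ih _ true prN.
set P := p ++ b :: r in bs bt prN.
have sN : (size (P ++ false :: s) <= N)%N by rewrite size_cat /= sk.
have tN : (size (P ++ true :: t) <= N)%N by rewrite size_cat /= tk.
have [a [c d]] := tree_code_fork t sN.
have k0 : (0 : R) < 2 ^+ k by rewrite exprn_gt0.
set x := _ *: _ in br; set y := _ *: _ in bs; set z := _ *: _ in bt.
(* The codes fork at [P], which yields a deviation of at least 2^k; this cancels the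
   normalisation. *)
have yz : th <= `|y - z|.
  rewrite /y /z -scalerBr opprB addrA subrK normrZ gtr0_norm ?invr_gt0//.
  rewrite mulrC ler_pdivlMr//; apply: le_trans (fsep a c _ _).
  by rewrite ler_pM2l// !vE// -natrX ler_nat -sk.
have mid u q : (size u).+1 = (2 ^ k)%N -> forall c,
    q = (2 ^+ k)^-1 *: (g (P ++ c :: u) - g P) ->
    th / 2 <= `|x - q| -> bush K (th / 2) k q ->
    exists r', (size r').+1 = (2 ^ k.+1)%N /\
    bush K (th / 2) k.+1 ((2 ^+ k.+1)^-1 *: (g (p ++ b :: r') - g p)).
  move=> uk e qE xq bq; exists (r ++ e :: u).
  rewrite size_cat /= uk -addSn rk addnn -mul2n -expnS; split=> //.
  rewrite -cat_cons catA -/P exprS invfM -scalerA.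
  rewrite (_ : g _ - g p = (g P - g p) + (g (P ++ e :: u) - g P)).
    by rewrite scalerDr -qE; exact: bush_midpoint.
  by rewrite [RHS]addrC addrA subrK.
have [xy|xy] := leP (th / 2) `|x - y|; first exact: (mid s y sk false).
apply: (mid t z tk true) => //; rewrite leNgt; apply/negP => xz.
have := ler_normB (x - z) (x - y); rewrite opprB addrC addrA subrK.
by move: yz xy xz; lra.
Qed.

End BinaryTrees.

(** * The theorem *)

Lemma family_coding (F : graph_family) N :
  exists n phi, coding (G := family_graph F N) n phi.
Proof.
case: F => /=.
- by do 2!eexists; exact: binary_tree_coding.
- rewrite /diamond_graph -iter_replaceE; do 2!eexists.
  exact: (gadget_graph_coding (ltn0Sn 1) diamond_consistent diamond_covered N diamond_metric).
- rewrite /laakso_graph -iter_replaceE; do 2!eexists.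
  exact: (gadget_graph_coding (ltn0Sn 3) laakso_consistent laakso_covered N laakso_metric).
Qed.

Lemma bush_le (R : realType) (X : normedModType R) (K : set X) (th th' : R) N x :
  th <= th' -> bush K th' N x -> bush K th N x.
Proof.
move=> tt'; elim: N x => //= N ih x [p [q1 [q2 [r [[/ih bp /ih b1 /ih b2 /ih br] xE d]]]]].
by exists p, q1, q2, r; split=> //; exact: le_trans d.
Qed.

(** Binary trees need height 2^N for a bush of depth N and lose half of the separation; the bushes
    of the other two families are weakened to the same constant. *)
Lemma family_bush (R : realType) (X : normedModType R) (L : set X) (F : graph_family)
    (theta : R) : 0 < theta ->
  (forall N, exists f : graph_space R (family_graph F N) -> X,
     theta_separated theta f /\ ave f `<=` closed_absconvex_hull L) ->
  forall N, exists x, bush (bipolar L) (theta / 2) N x.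
Proof.
move=> th0 maps N.
have half : theta / 2 <= theta by lra.
have LN := @bipolarN R X L.
(* Quantifying over the graph allows [iter] to be rewritten as [iter_replace] before the dependent
   map is introduced. *)
pose P G := (forall x y : vertex G, connect (@graph_adj G) x y) ->
  (exists f : graph_space R G -> X,
     theta_separated theta f /\ ave f `<=` closed_absconvex_hull L) ->
  exists x, bush (bipolar L) (theta / 2) N x.
case: F maps => maps.
- have [f [fsep fave]] := maps (2 ^ N)%N.
  have cod := binary_tree_coding (2 ^ N); have conn := @binary_tree_connected (2 ^ N).
  apply: (binary_tree_bush (N := (2 ^ N)%N) (f := f) th0) => // [x y|k l x y].
    exact: (separated_adj fave).
  exact: (separated_dev cod conn th0 fsep).
- suff : P (diamond_graph N) by apply; [exact: diamond_graph_connected|exact: maps].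
  rewrite /diamond_graph -iter_replaceE => conn [f [fsep fave]].
  have cod := gadget_graph_coding (ltn0Sn 1) diamond_consistent diamond_covered N diamond_metric.
  have [x bx] := gadget_graph_bush (ltn0Sn 1) diamond_consistent (K := bipolar L) th0
    (f := f) (@diamond_bush R X (bipolar L) theta LN) (separated_adj fave)
    (separated_dev cod conn th0 fsep).
  by exists x; exact: bush_le bx.
- suff : P (laakso_graph N) by apply; [exact: laakso_graph_connected|exact: maps].
  rewrite /laakso_graph -iter_replaceE => conn [f [fsep fave]].
  have cod := gadget_graph_coding (ltn0Sn 3) laakso_consistent laakso_covered N laakso_metric.
  have [x bx] := gadget_graph_bush (ltn0Sn 3) laakso_consistent (K := bipolar L) th0
    (f := f) (@laakso_bush R X (bipolar L) theta) (separated_adj fave)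
    (separated_dev cod conn th0 fsep).
  by exists x; exact: bush_le bx.
Qed.

Theorem theorem5p1 (R : realType) (X : completeNormedModType R) (L : set X)
    (F : graph_family) :
  bounded_set L ->
  (~ relatively_super_weakly_compact L) <->
  (exists2 theta : R, 0 < theta &
     exists f : forall N : nat, graph_space R (family_graph F N) -> X,
       forall N : nat, theta_separated theta (f N) /\
         ave (f N) `<=` closed_absconvex_hull L).
Proof.
move=> Lb; split=> [nswc|[theta th0 [f fP]]]; last first.
  apply: (bushes_not_super_weakly_compact (th := theta / 2) Lb).
    by rewrite divr_gt0.
  by apply: (family_bush (F := F) th0) => N; exists (f N).
have [th th0 sums] := not_super_weakly_compact_summing Lb nswc.
exists (th / 4); first by rewrite divr_gt0.
suff maps N : exists f : graph_space R (family_graph F N) -> X,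
    theta_separated (th / 4) f /\ ave f `<=` closed_absconvex_hull L.
  by exists (fun N => projT1 (cid (maps N))) => N; exact: projT2 (cid (maps N)).
have [n [phi cod]] := family_coding F N.
have [x Lx xsum] := sums n.
exact: (coding_map cod (@family_graph_connected F N) th0 Lx xsum).
Qed.
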